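(* Consider type A3 in finite dimension (see context): $V=V_+\oplus V_-$, $\phi$, $\delta$, $K$, $G^0$ and the variety $X$ of complete flags of $V$, with $n=\dim V$. Let $(p,q)=(\dim V_+,\dim V_-)$. Then: (a) For every $(w,\varepsilon)\in\mathfrak{I}_n(p,q)$ the subsets $\mathcal{O}_{(w,\varepsilon)}$ and $\mathfrak{O}_{(w,\varepsilon)}$ are nonempty, and $$\mathcal{O}_{(w,\varepsilon)}\cap\mathfrak{O}_{(w,\varepsilon)}=\{\mathcal{F}(\underline{v}):\underline{v}=(v_k)_{k=1}^n\text{ is }(w,\varepsilon)\text{-dual and }(w,\varepsilon)\text{-conjugate}\}\ne\emptyset.$$ (b) For every $(w,\varepsilon)\in\mathfrak{I}_n(p,q)$, $$\mathcal{O}_{(w,\varepsilon)}=\{\mathcal{F}\in X:(\delta(\mathcal{F}),\mathcal{F})\in\mathbb{O}_w\text{ and }\varsigma(\delta:\mathcal{F})=\varsigma(w,\varepsilon)\},$$ $$\mathfrak{O}_{(w,\varepsilon)}=\{\mathcal{F}\in X:(\mathcal{F}^\dag,\mathcal{F})\in\mathbb{O}_{w_0w}\text{ and }\varsigma(\phi:\mathcal{F})=\varsigma(w,\varepsilon)\}.$$ (c) The subsets $\mathcal{O}_{(w,\varepsilon)}$ ($(w,\varepsilon)\in\mathfrak{I}_n(p,q)$) are exactly the $K$-orbits of $X$. The subsets $\mathfrak{O}_{(w,\varepsilon)}$ ($(w,\varepsilon)\in\mathfrak{I}_n(p,q)$) are exactly the $G^0$-orbits of $X$. (d) The map $\mathcal{O}_{(w,\varepsilon)}\mapsto\mathfrak{O}_{(w,\varepsilon)}$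 is Matsuki duality.
   Context: Let $V=\langle e_1,\ldots,e_n\rangle_{\mathbb{C}}$ with vectors identified with coordinate columns and $\overline{x}$ the coordinatewise conjugate. Let $\Phi$ be a diagonal $n\times n$ matrix with diagonal entries $\epsilon_1,\ldots,\epsilon_n\in\{+1,-1\}$, $\phi(x,y)={}^t\overline{x}\,\Phi\,y$, $\delta(x)=\Phi x$, $V_+=\langle e_k:\epsilon_k=1\rangle_{\mathbb C}$, $V_-=\langle e_k:\epsilon_k=-1\rangle_{\mathbb C}$. Let $K=\{g\in\mathrm{GL}(V):\delta g=g\delta\}=\mathrm{GL}(V_+)\times\mathrm{GL}(V_-)$ and $G^0=\{g\in\mathrm{GL}(V):g\text{ preserves }\phi\}$. $X$ is the variety of complete flags $\mathcal{F}=(F_0\subset\cdots\subset F_n=V)$, $\dim F_k=k$; $\mathcal{F}(v_1,\ldots,v_n)$ is the flag with $F_k=\langle v_1,\ldots,v_k\rangle_{\mathbb{C}}$. Put $\delta(\mathcal{F})=(\delta(F_0),\ldots,\delta(F_n))$ and $\mathcal{F}^\dag=(F_n^\dag,\ldots,F_0^\dag)$, where $F^\dag$ is the $\phi$-orthogonal of $F$. For $w\in\mathfrak{S}_n$ (write $w_k=w(k)$), $\mathbb{O}_w\subset X\times X$ is the set of pairs $(\mathcal{F},\mathcal{F}')$ with $\dim F_k\cap F'_\ell=|\{j\in\{1,\ldots,\ell\}:w_j\in\{1,\ldots,k\}\}|$ for all $k,\ell$. $w_0(k)=n-k+1$. $\varsigma(\phi:F)\in\mathbb{Z}_{\ge0}^2$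 denotes the signature of the nondegenerate hermitian form induced by $\phi$ on $F/(F\cap F^\dag)$; $\varsigma(\phi:\mathcal{F})=(\varsigma(\phi:F_\ell))_{\ell=1}^n$ and $\varsigma(\delta:\mathcal{F})=((\dim F_\ell\cap V_+,\dim F_\ell\cap V_-))_{\ell=1}^n$. A signed involution is a pair $(w,\varepsilon)$ with $w\in\mathfrak{S}_n$, $w^2=\mathrm{id}$, and $\varepsilon:\{k:w_k=k\}\to\{+1,-1\}$, $k\mapsto\varepsilon_k$. Define $\varsigma(w,\varepsilon)=((p_\ell,q_\ell))_{\ell=1}^n$ by $p_\ell=|\{k\le\ell:w_k=k,\varepsilon_k=+1\}|+|\{k\le\ell:w_k<k\}|$, $q_\ell=|\{k\le\ell:w_k=k,\varepsilon_k=-1\}|+|\{k\le\ell:w_k<k\}|$. For $n=p+q$, $\mathfrak{I}_n(p,q)$ is the set of signed involutions with $(p_n,q_n)=(p,q)$. A basis $(v_1,\ldots,v_n)$ of $V$ is $(w,\varepsilon)$-conjugate if for all $k$: $\delta(v_k)=\varepsilon_kv_k$ when $w_k=k$ and $\delta(v_k)=v_{w_k}$ when $w_k\ne k$. It is $(w,\varepsilon)$-dual if for all $k,\ell$: $\phi(v_k,v_\ell)=\varepsilon_k$ if $w_k=\ell=k$, $=1$ if $w_k=\ell\ne k$, $=0$ if $w_k\ne\ell$. Put $\mathcal{O}_{(w,\varepsilon)}=\{\mathcal{F}(\underline v):\underline v\ (w,\varepsilon)\text{-conjugate}\}$, $\mathfrak{O}_{(w,\varepsilon)}=\{\mathcal{F}(\underline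 v):\underline v\ (w,\varepsilon)\text{-dual}\}$. Matsuki duality is the unique bijection $\Xi$ from the set of $K$-orbits of $X$ to the set of $G^0$-orbits of $X$ such that $\mathcal{O}\cap\Xi(\mathcal{O})$ is a single $K\cap G^0$-orbit for every $K$-orbit $\mathcal{O}$. *)

(* Defs.v *)
From mathcomp Require Import all_boot all_order all_fingroup all_algebra.
From mathcomp Require Import boolp classical_sets functions cardinality reals.
From mathcomp Require Export complex.

Set Implicit Arguments.
Unset Strict Implicit.
Unset Printing Implicit Defensive.

Import Order.TTheory GRing.Theory Num.Theory.

Local Open Scope classical_set_scope.
Local Open Scope ring_scope.

(* Everything is set over a numClosedFieldType C, with
   conjugation z^*; the field of complex numbers is C = R[i] for R : realType.
   Indices are 0-based: 'I_n stands for {1, ..., n}, and j : 'I_n belongs to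
   {1, ..., l} iff j < l. Signs are elements 1, -1 of int. *)

Definition sign_vector n (eps : 'I_n -> int) : Prop :=
  forall k, eps k = 1 \/ eps k = -1.

Definition Phi (C : numClosedFieldType) n (eps : 'I_n -> int) : 'M[C]_n :=
  diag_mx (\row_k (eps k)%:~R).

Definition conj_vec (C : numClosedFieldType) n (x : 'cV[C]_n) : 'cV[C]_n :=
  \col_k (x k 0)^*.

Definition phi (C : numClosedFieldType) n (eps : 'I_n -> int)
    (x y : 'cV[C]_n) : C :=
  ((conj_vec x)^T *m Phi C eps *m y) 0 0.

Definition Vplus (C : numClosedFieldType) n (eps : 'I_n -> int) :
    {vspace 'cV[C]_n} :=
  (\sum_(k < n | (eps k == 1)%R) <[delta_mx k ord0]>)%VS.

Definition Vminus (C : numClosedFieldType) n (eps : 'I_n -> int) :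
    {vspace 'cV[C]_n} :=
  (\sum_(k < n | (eps k == -1)%R) <[delta_mx k ord0]>)%VS.

Definition vimg (C : numClosedFieldType) n (g : 'M[C]_n)
    (F : {vspace 'cV[C]_n}) : {vspace 'cV[C]_n} :=
  (linfun (mulmx g) @: F)%VS.

(* F^dag, characterized by mem_dag. *)
Definition dag (C : numClosedFieldType) n (eps : 'I_n -> int)
    (F : {vspace 'cV[C]_n}) : {vspace 'cV[C]_n} :=
  (\bigcap_(x <- vbasis F)
     lker (linfun (mulmx ((conj_vec x)^T *m Phi C eps))))%VS.

Lemma phiE (C : numClosedFieldType) n (eps : 'I_n -> int) (x y : 'cV[C]_n) :
  phi eps x y = \sum_k (x k 0)^* * (eps k)%:~R * y k 0.
Proof.
rewrite /phi mxE; apply: eq_bigr => k _; congr (_ * _).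
by rewrite /Phi mul_mx_diag !mxE.
Qed.

Lemma mem_dag (C : numClosedFieldType) n (eps : 'I_n -> int)
    (F : {vspace 'cV[C]_n}) (y : 'cV[C]_n) :
  y \in dag eps F <-> (forall x, x \in F -> phi eps x y = 0).
Proof.
have kerE (x : 'cV[C]_n) :
    (y \in lker (linfun (mulmx ((conj_vec x)^T *m Phi C eps)))) =
    (phi eps x y == 0).
  rewrite memv_ker lfunE /= /phi.
  apply/eqP/eqP => [-> | h]; first by rewrite mxE.
  by apply/matrixP => i j; rewrite !ord1 h mxE.
have bigE (s : seq 'cV[C]_n) : (y \in (\bigcap_(x <- s)
     lker (linfun (mulmx ((conj_vec x)^T *m Phi C eps))))%VS) =
    all (fun x => phi eps x y == 0) s.
  elim: s => [|x s IHs]; first by rewrite big_nil memvf.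
  by rewrite big_cons memv_cap IHs kerE.
rewrite /dag bigE; split=> [/allP h x xF | h].
  rewrite (coord_vbasis xF).
  have -> : phi eps (\sum_(i < \dim F) coord (vbasis F) i x *: (vbasis F)`_i) y
      = \sum_(i < \dim F) (coord (vbasis F) i x)^* * phi eps (vbasis F)`_i y.
    rewrite phiE.
    under [RHS]eq_bigr => i _ do rewrite phiE mulr_sumr.
    rewrite exchange_big /=; apply: eq_bigr => k _.
    rewrite summxE rmorph_sum !mulr_suml; apply: eq_bigr => i _.
    by rewrite mxE rmorphM /= !mulrA.
  apply: big1 => i _; rewrite (eqP (h _ _)) ?mulr0 //.
  by rewrite mem_nth // size_tuple.
by apply/allP => x /vbasis_mem xF; apply/eqP/h.
Qed.

Definition Kgrp (C : numClosedFieldType) n (eps : 'I_n -> int) :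
    set 'M[C]_n :=
  [set g | g \in unitmx /\ Phi C eps *m g = g *m Phi C eps].
Arguments Kgrp C {n} eps _.

Definition G0grp (C : numClosedFieldType) n (eps : 'I_n -> int) :
    set 'M[C]_n :=
  [set g | g \in unitmx /\
     forall x y : 'cV[C]_n, phi eps (g *m x) (g *m y) = phi eps x y].
Arguments G0grp C {n} eps _.

(* The underlying sequence (F_0, ..., F_n) of a flag. *)
Definition preflag (C : numClosedFieldType) (n : nat) : Type :=
  {ffun 'I_n.+1 -> {vspace 'cV[C]_n}}.

Definition flags (C : numClosedFieldType) n : set (preflag C n) :=
  [set F : preflag C n | [/\ forall k : 'I_n.+1, \dim (F k) = k,
               forall k l : 'I_n.+1, (k <= l)%N -> (F k <= F l)%VS
             & F ord_max = fullv]].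
Arguments flags C n _ : clear implicits.

Definition flag_of (C : numClosedFieldType) n (v : n.-tuple 'cV[C]_n) :
    preflag C n :=
  [ffun k : 'I_n.+1 => <<take k v>>%VS].

Definition flag_act (C : numClosedFieldType) n (g : 'M[C]_n)
    (F : preflag C n) : preflag C n :=
  [ffun k => vimg g (F k)].

Definition flag_delta (C : numClosedFieldType) n (eps : 'I_n -> int)
    (F : preflag C n) : preflag C n :=
  flag_act (Phi C eps) F.

Definition flag_dag (C : numClosedFieldType) n (eps : 'I_n -> int)
    (F : preflag C n) : preflag C n :=
  [ffun k => dag eps (F (rev_ord k))].

Definition flag_orbit (C : numClosedFieldType) n (H : set 'M[C]_n)
    (F : preflag C n) : set (preflag C n) :=
  [set flag_act g F | g in H].

Definition flag_orbits (C : numClosedFieldType) n (H : set 'M[C]_n) :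
    set (set (preflag C n)) :=
  [set flag_orbit H F | F in flags C n].

(* The set O_w of pairs of flags in relative position w. *)
Definition relpos (C : numClosedFieldType) n (w : 'S_n) :
    set (preflag C n * preflag C n) :=
  [set FF | [/\ flags C n FF.1, flags C n FF.2
     & forall k l : 'I_n.+1, \dim (FF.1 k :&: FF.2 l)%VS =
         #|[set j : 'I_n | (j < l)%N && (w j < k)%N]%SET| ]].
Arguments relpos C {n} w _.

Definition w0 (n : nat) : 'S_n := perm (@rev_ord_inj n).

(* (p, q) is the signature of the form induced by phi on F / (F :&: F^dag):
   the classes of the vectors of b are a basis of this quotient, orthogonal
   for the induced form, with p positive and q negative squares.  In the order
   of C, 0 < z (resp. z < 0) entails that z is real. *)
Definition is_signature (C : numClosedFieldType) n (eps : 'I_n -> int)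
    (F : {vspace 'cV[C]_n}) (pq : nat * nat) : Prop :=
  exists b : seq 'cV[C]_n,
    [/\ free b,
        (<<b>> :&: (F :&: dag eps F) = 0)%VS,
        (<<b>> + (F :&: dag eps F) = F)%VS,
        (forall i j, (i < size b)%N -> (j < size b)%N -> i != j ->
           phi eps b`_i b`_j = 0)
      & pq = (count (fun x => 0 < phi eps x x) b,
              count (fun x => phi eps x x < 0) b)].

(* The pair is unique, by Sylvester's law of inertia. *)
Definition signature (C : numClosedFieldType) n (eps : 'I_n -> int)
    (F : {vspace 'cV[C]_n}) : nat * nat :=
  xget (0%N, 0%N) [set pq | is_signature eps F pq].

(* Families indexed by l = 1, ..., n: the index l : 'I_n stands for l + 1. *)
Definition sig_phi (C : numClosedFieldType) n (eps : 'I_n -> int)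
    (F : preflag C n) : {ffun 'I_n -> nat * nat} :=
  [ffun l => signature eps (F (lift ord0 l))].

Definition sig_delta (C : numClosedFieldType) n (eps : 'I_n -> int)
    (F : preflag C n) : {ffun 'I_n -> nat * nat} :=
  [ffun l => (\dim (F (lift ord0 l) :&: Vplus C eps)%VS,
              \dim (F (lift ord0 l) :&: Vminus C eps)%VS)].

(* The partial function {k | w k = k} -> {1, -1} is extended by 0, so that
   signed involutions correspond bijectively to such pairs. *)
Definition signed_involution n (we : 'S_n * {ffun 'I_n -> int}) : Prop :=
  (we.1 ^+ 2 = 1)%g /\
  forall k, if we.1 k == k then we.2 k = 1 \/ we.2 k = -1 else we.2 k = 0.

(* (p_l, q_l), for l = 0, ..., n *)
Definition pq_inv n (we : 'S_n * {ffun 'I_n -> int}) (l : nat) : nat * nat :=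
  let fixed (s : int) :=
    #|[set k : 'I_n | [&& (k < l)%N, we.1 k == k & we.2 k == s]]%SET| in
  let pairs := #|[set k : 'I_n | (k < l)%N && (we.1 k < k)%N]%SET| in
  ((fixed 1%R + pairs)%N, (fixed (-1)%R + pairs)%N).

Definition sig_inv n (we : 'S_n * {ffun 'I_n -> int}) :
    {ffun 'I_n -> nat * nat} :=
  [ffun l : 'I_n => pq_inv we l.+1].

Definition signed_involutions (n p q : nat) :
    set ('S_n * {ffun 'I_n -> int}) :=
  [set we | signed_involution we /\ pq_inv we n = (p, q)].
Arguments signed_involutions n p q _ : clear implicits.

Definition conjugate_basis (C : numClosedFieldType) n (eps : 'I_n -> int)
    (we : 'S_n * {ffun 'I_n -> int}) : set (n.-tuple 'cV[C]_n) :=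
  [set v : n.-tuple 'cV[C]_n | basis_of fullv v /\ forall k : 'I_n,
     (we.1 k = k -> Phi C eps *m tnth v k = (we.2 k)%:~R *: tnth v k) /\
     (we.1 k <> k -> Phi C eps *m tnth v k = tnth v (we.1 k))].
Arguments conjugate_basis C {n} eps we _.

Definition dual_basis (C : numClosedFieldType) n (eps : 'I_n -> int)
    (we : 'S_n * {ffun 'I_n -> int}) : set (n.-tuple 'cV[C]_n) :=
  [set v : n.-tuple 'cV[C]_n | basis_of fullv v /\ forall k l : 'I_n,
     [/\ we.1 k = l -> l = k -> phi eps (tnth v k) (tnth v l) = (we.2 k)%:~R,
         we.1 k = l -> l <> k -> phi eps (tnth v k) (tnth v l) = 1
       & we.1 k <> l -> phi eps (tnth v k) (tnth v l) = 0]].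
Arguments dual_basis C {n} eps we _.

Definition conjugate_flags (C : numClosedFieldType) n (eps : 'I_n -> int)
    (we : 'S_n * {ffun 'I_n -> int}) : set (preflag C n) :=
  [set flag_of v | v in conjugate_basis C eps we].
Arguments conjugate_flags C {n} eps we _.

Definition dual_flags (C : numClosedFieldType) n (eps : 'I_n -> int)
    (we : 'S_n * {ffun 'I_n -> int}) : set (preflag C n) :=
  [set flag_of v | v in dual_basis C eps we].
Arguments dual_flags C {n} eps we _.

Definition matsuki_condition (C : numClosedFieldType) n (eps : 'I_n -> int)
    (Xi : set (preflag C n) -> set (preflag C n)) : Prop :=
  set_bij (flag_orbits (Kgrp C eps)) (flag_orbits (G0grp C eps)) Xi /\
  forall O, flag_orbits (Kgrp C eps) O ->
    flag_orbits (Kgrp C eps `&` G0grp C eps) (O `&` Xi O).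

(* Only the values of Xi on K-orbits are relevant. *)
Definition matsuki_duality (C : numClosedFieldType) n (eps : 'I_n -> int)
    (Xi : set (preflag C n) -> set (preflag C n)) : Prop :=
  matsuki_condition eps Xi /\
  forall Xi', matsuki_condition eps Xi' ->
    forall O, flag_orbits (Kgrp C eps) O -> Xi' O = Xi O.

(* Main.v *)
Require Import Defs.
From mathcomp Require Import all_boot all_order all_fingroup all_algebra.
From mathcomp Require Import boolp classical_sets functions reals.
From mathcomp Require Import complex.

(** All the subsets in play are described by two families of integers attached
    to a flag F: relative positions, and indices of signature.  The proof
    consists in computing them on flags spanned by conjugate and dual bases
    ([conjugate_rank], [conjugate_eigen], [dual_rank], [dual_signature]),
    observing that they determine the signed involution ([invariants_inj]), and
    showing that every flag is spanned by a conjugate basis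
    ([conjugate_exists]) and by a dual one ([dual_exists]).  Two conjugate bases
    for the same signed involution differ by a unique matrix, which commutes
    with delta because it intertwines the actions of delta on the two bases;
    likewise for dual bases and phi.  Hence the orbits, their parametrization
    and their characterization by invariants.

    The existence of a conjugate basis needs no induction.  Among the vectors x
    of F_k outside F_(k-1), choose one whose image delta(x) lies as early as
    possible in F, say in F_(w k) and not before.  Minimality makes w an
    involution; a vector x chosen at k < w k, together with delta(x) put at
    w k, supplies a pair of the basis, and at a fixed point one of
    x + delta(x), x - delta(x) is an eigenvector still outside F_(k-1).

    A dual basis is obtained by a triangular reduction of the Gram matrix: the
    first vector not yet treated is either anisotropic and split off, or
    isotropic, and then it is paired with the first vector not orthogonal to it
    to form a hyperbolic plane which is split off.  Applied to the definite
    form of signature (n, 0), the same reduction is the Gram-Schmidt process.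

    Everything relating the two kinds of orbits rests on the identity
    phi(x, y) = <delta(x), y>, where <,> is the standard inner product
    ([phi_dot]).  It shows that delta(F_m) meets the orthogonal of F_m
    trivially, and that phi is definite on the eigenspaces of delta; so, through
    a flag lying in the conjugate orbit of (w, e) and in the dual orbit of
    (w', e'), all the invariants of (w, e) are at most those of (w', e')
    ([conjugate_dual_le]).  When the two signed involutions coincide,
    equality of the ranks means that each F_l is the orthogonal sum of its
    intersections with delta(F_m) and its orthogonal.  The orthogonal
    projections attached to the flag and to its image under delta therefore
    commute, so that delta permutes the lines of an orthonormal basis adapted
    to F ([conjugate_dual_monomial]), and rescaling this basis makes it
    both conjugate and dual ([conjugate_dual_basis]).  Thus the intersection of
    the two orbits is one orbit of the common subgroup; it is not empty
    because a suitable permutation of the standard basis, with the two vectors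
    of each pair rotated, is at once orthonormal and conjugate
    ([orthonormal_conjugate_exists]).

    For the uniqueness of Matsuki duality, let Xi be another bijection with the
    same property.  The orbit Xi(O) meets O, so by the comparison above
    it is either the expected orbit or one whose invariants have a
    strictly larger sum ([incident_eq_or_lt]).  In the second case, descending
    induction on this sum shows that Xi already takes the value Xi(O) at another
    orbit, against injectivity ([matsuki_unique]). *)

Set Implicit Arguments.
Unset Strict Implicit.
Unset Printing Implicit Defensive.

Import Order.TTheory GRing.Theory Num.Theory.

Local Open Scope classical_set_scope.
Local Open Scope ring_scope.

(** * Complete flags *)

Section Flags.
Variables (C : numClosedFieldType) (n : nat).
Implicit Types (F : preflag C n) (x y : 'cV[C]_n) (U : {vspace 'cV[C]_n}).
Implicit Types (v : n.-tuple 'cV[C]_n) (j k : 'I_n) (l m : nat).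

(** Natural number indices avoid the casts between ['I_n] and ['I_n.+1]. *)
Definition part F l := F (inord l).

(** The step at which a vector appears in a flag.  A nonzero vector enters at
    exactly one index, which replaces dimension counts by statements about
    single vectors. *)
Definition enters F l x := (x \in part F l.+1) && (x \notin part F l).

Lemma partE F (k : 'I_n.+1) : F k = part F k.
Proof. by rewrite /part inord_val. Qed.

Lemma dim_part F l : flags C n F -> (l <= n)%N -> \dim (part F l) = l.
Proof. by case=> dimF _ _ ln; rewrite dimF inordK. Qed.

Lemma part_sub F l m :
  flags C n F -> (l <= m <= n)%N -> (part F l <= part F m)%VS.
Proof.
by case=> _ subF _ /andP[lm mn]; rewrite subF // !inordK // ltnS (leq_trans lm).
Qed.

Lemma part_mem F l m x :
  flags C n F -> (l <= m <= n)%N -> x \in part F l -> x \in part F m.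
Proof. by move=> fF lm; apply/subvP/part_sub. Qed.

Lemma part_full F : flags C n F -> part F n = fullv.
Proof. by case=> _ _ <-; congr (F _); apply: val_inj; rewrite /= inordK. Qed.

Lemma part0 F : flags C n F -> part F 0 = 0%VS.
Proof. by move=> fF; apply/eqP; rewrite -dimv_eq0 dim_part. Qed.

Lemma eq_part F F' : (forall l, (l <= n)%N -> part F l = part F' l) -> F = F'.
Proof. by move=> eqF; apply/ffunP=> k; rewrite !partE eqF // -ltnS. Qed.

Lemma enters_part F l x : enters F l x -> x \in part F l.+1.
Proof. by case/andP. Qed.

Lemma enters_neq0 F l x : enters F l x -> x != 0.
Proof. by case/andP=> _; apply: contraNneq => ->; rewrite mem0v. Qed.

Lemma enters_exists F l x : flags C n F -> (l <= n)%N -> x != 0 -> x \in part F l ->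
  exists k, (k < l)%N /\ enters F k x.
Proof.
move=> fF ln x0; elim: l ln => [|l IHl] ln.
  by rewrite part0 // memv0 (negPf x0).
move=> xl; have [xl'|xl'] := boolP (x \in part F l).
  by have [k [kl ek]] := IHl (ltnW ln) xl'; exists k; split=> //; apply: ltnW.
by exists (Ordinal ln); split=> //=; apply/andP.
Qed.

Lemma entersP F x : flags C n F -> x != 0 -> exists k, enters F k x.
Proof.
move=> fF x0; have [|k [_ ek]] := enters_exists fF (leqnn n) x0; last by exists k.
by rewrite part_full // memvf.
Qed.

Lemma enters_mem F k l x :
  flags C n F -> enters F k x -> (l <= n)%N -> (x \in part F l) = (k < l)%N.
Proof.
move=> fF /andP[xk xk'] ln; apply/idP/idP => [xl|kl].
  rewrite ltnNge; apply: contra xk' => lk; apply: part_mem xl => //.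
  by rewrite lk ltnW.
by apply: part_mem xk => //; rewrite kl.
Qed.

Lemma enters_uniq F j k x :
  flags C n F -> enters F j x -> enters F k x -> j = k.
Proof.
move=> fF ej ek; apply: val_inj; apply/eqP; rewrite eqn_leq /=.
rewrite -ltnS -(enters_mem fF ej) // (enters_part ek) /=.
by rewrite -ltnS -(enters_mem fF ek) // (enters_part ej).
Qed.

Lemma entersD F k x y a : flags C n F -> a != 0 ->
  enters F k x -> y \in part F k -> enters F k (a *: x + y).
Proof.
move=> fF a0 /andP[xk xk'] yk; apply/andP; split.
  by apply: memvD; rewrite ?memvZ //; apply: part_mem yk => //; rewrite leqnSn ltn_ord.
by apply: contra xk' => h; rewrite -(scalerK a0 x) memvZ // -(addrK y (_ *: x)) memvB.
Qed.

Lemma partS F k x :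
  flags C n F -> enters F k x -> part F k.+1 = (part F k + <[x]>)%VS.
Proof.
move=> fF ekx; have /andP[xk xk'] := ekx; apply/esym/eqP; rewrite eqEdim.
rewrite subv_add part_sub ?leqnSn ?ltn_ord //= -memvE xk /=.
rewrite dimv_disjoint_sum ?dim_vline ?(enters_neq0 ekx) ?dim_part ?addn1 //.
  exact: ltnW.
apply/eqP; rewrite -subv0; apply/subvP => y /memv_capP[yk /vlineP[a ya]].
have [a0|a0] := eqVneq a 0; first by rewrite ya a0 scale0r mem0v.
by move: xk'; rewrite -(scalerK a0 x) -ya memvZ.
Qed.

(** Consecutive terms differ by one dimension, so a vector entering at [k]
    allows the elimination of the component of any other one at this step. *)
Lemma enters_line F k x y : flags C n F -> enters F k x ->
  y \in part F k.+1 -> exists a, y - a *: x \in part F k.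
Proof.
move=> fF ekx; rewrite (partS fF ekx) => /memv_addP[u uk [_ /vlineP[a ->] ->]].
by exists a; rewrite addrK.
Qed.

Lemma exists_enters F k : flags C n F -> exists x, enters F k x.
Proof.
move=> fF; have : ~~ (part F k.+1 <= part F k)%VS.
  by apply/negP=> /dimvS; rewrite !dim_part ?ltnn // ltnW.
by case/subvPn=> x xk xk'; exists x; apply/andP.
Qed.

(** A subspace meets the terms of a flag in dimensions which jump by one at
    each index where one of its vectors enters the flag; every dimension below
    is obtained by determining these indices. *)
Lemma dim_part_cap F U (P : pred 'I_n) l : flags C n F -> (l <= n)%N ->
  (forall k, reflect (exists2 x, x \in U & enters F k x) (P k)) ->
  \dim (part F l :&: U)%VS = #|[set k : 'I_n | (k < l)%N && P k]%SET|.
Proof.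
move=> fF + Pr; elim: l => [|l IHl] ln.
  by rewrite part0 // cap0v dimv0 fintype.eq_card0 // => k; rewrite inE ltn0.
pose k := Ordinal ln; have -> : #|[set j : 'I_n | (j < l.+1)%N && P j]%SET| =
   (#|[set j : 'I_n | (j < l)%N && P j]%SET| + P k)%N.
  have -> : [set j : 'I_n | (j < l.+1)%N && P j]%SET =
     ([set j : 'I_n | (j < l)%N && P j]%SET :|: [set j | (j == k) && P j]%SET)%SET.
    apply/setP=> j; rewrite !inE ltnS leq_eqVlt -andb_orl orbC.
    by congr ((_ || _) && _).
  rewrite cardsU (_ : (_ :&: _)%SET = finset.set0).
    rewrite cards0 subn0; congr addn; case Pk: (P k).
      by rewrite (@fintype.eq_card1 _ k) // => j; rewrite !inE; case: eqP => // ->.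
    by rewrite fintype.eq_card0 // => j; rewrite !inE; case: eqP => // ->.
  apply/setP=> j; rewrite !inE; apply/negP => /andP[/andP[jl _] /andP[/eqP jk _]].
  by move: jl; rewrite jk ltnn.
rewrite -(IHl (ltnW ln)); have sub : (part F l <= part F l.+1)%VS.
  by rewrite part_sub // leqnSn.
case: Pr => [[x xU ekx]|nx].
  rewrite (partS (k := k) fF ekx) capvC -vspace_modr -?memvE // capvC.
  rewrite dimv_disjoint_sum ?dim_vline ?(enters_neq0 ekx) //.
  apply/eqP; rewrite -subv0; apply/subvP => y /memv_capP[/memv_capP[yk _] /vlineP[a ya]].
  have [a0|a0] := eqVneq a 0; first by rewrite ya a0 scale0r mem0v.
  by case/andP: ekx => _; rewrite -(scalerK a0 x) -ya memvZ.
rewrite addn0; congr (\dim _); apply/vspaceP => x; rewrite !memv_cap.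
have [xU|] := boolP (x \in U); rewrite ?andbF // !andbT.
apply/idP/idP => [xl|]; last exact: (subvP sub).
by apply/negPn/negP => xl'; case: nx; exists x => //; apply/andP.
Qed.
End Flags.

(** * Bases adapted to a flag *)

Section Bases.
Variables (C : numClosedFieldType) (n : nat).
Implicit Types (F : preflag C n) (x y : 'cV[C]_n) (U : {vspace 'cV[C]_n}).
Implicit Types (v : n.-tuple 'cV[C]_n) (i j k : 'I_n) (l m : nat).
Implicit Types (w : 'S_n) (d : 'I_n -> C).

Lemma part_flag_of v l : (l <= n)%N -> part (flag_of v) l = <<take l v>>%VS.
Proof. by move=> ln; rewrite /part ffunE inordK. Qed.

Lemma dim_fullv : \dim (fullv : {vspace 'cV[C]_n}) = n.
Proof. by rewrite dimvf /dim /= muln1. Qed.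

Lemma take_rcons v k : take k.+1 v = rcons (take k v) (tnth v k).
Proof. by rewrite (tnth_nth 0) -take_nth ?size_tuple. Qed.

Lemma span_rcons (s : seq 'cV[C]_n) x : (<<rcons s x>> = <<s>> + <[x]>)%VS.
Proof. by rewrite -cats1 span_cat span_seq1. Qed.

(** Each entering vector increases the span by one dimension.  A basis adapted
    to a flag is thus obtained by choosing its vectors independently of each
    other. *)
Lemma flag_of_enters F v : flags C n F -> (forall k, enters F k (tnth v k)) ->
  basis_of fullv v /\ F = flag_of v.
Proof.
move=> fF ev.
have eqF l : (l <= n)%N -> part F l = <<take l v>>%VS.
  elim: l => [|l IHl] ln; first by rewrite part0 // take0 span_nil.
  by rewrite (take_rcons v (Ordinal ln)) span_rcons -IHl ?(ltnW ln) // -(partS (k := Ordinal ln)).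
split; last by apply: eq_part => l ln; rewrite eqF // part_flag_of.
rewrite basisEdim size_tuple dim_fullv leqnn andbT.
by rewrite -[tval v]take_size size_tuple -eqF // part_full.
Qed.

Section Basis.
Variables (v : n.-tuple 'cV[C]_n) (bv : basis_of fullv v).

Lemma coord_expand x : x = \sum_j coord v j x *: tnth v j.
Proof.
rewrite {1}(coord_basis bv (memvf x)).
by apply: eq_bigr => j _; rewrite (tnth_nth 0).
Qed.

Lemma coord_tnth i j : coord v i (tnth v j) = (j == i)%:R.
Proof. by rewrite (tnth_nth 0) coord_free ?(basis_free bv). Qed.

Lemma flag_of_basis : flags C n (flag_of v).
Proof.
have dimF l : (l <= n)%N -> \dim <<take l v>> = l.
  move=> ln; have : free (take l v).
    by apply: (@catl_free _ _ (drop l v)); rewrite cat_take_drop (basis_free bv).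
  by move/eqP; rewrite size_takel ?size_tuple.
split=> [k|k l kl|]; rewrite ?ffunE.
- by rewrite dimF // -ltnS.
- by apply: sub_span => x; rewrite -(subnKC kl) takeD mem_cat => ->.
- by rewrite take_oversize ?size_tuple // (span_basis bv).
Qed.

Lemma mem_flag_of x l : (l <= n)%N ->
  reflect (forall i, (l <= i)%N -> coord v i x = 0) (x \in part (flag_of v) l).
Proof.
move=> ln; rewrite part_flag_of //; apply: (iffP idP) => [xl i li|h].
  have : (<<take l v>> <= lker (linfun (coord v i : 'cV[C]_n -> C^o)))%VS.
    apply/span_subvP => y /(nthP 0)[j]; rewrite size_takel ?size_tuple // => jl <-.
    have jn := leq_trans jl ln; rewrite nth_take // memv_ker lfunE /=.
    rewrite -[j]/(val (Ordinal jn)) -tnth_nth coord_tnth.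
    by have [ij|//] := eqVneq (Ordinal jn) i; move: li; rewrite -ij leqNgt /= jl.
  by move/subvP/(_ x xl); rewrite memv_ker lfunE /= => /eqP.
rewrite (coord_expand x); apply: memv_suml => i _.
have [li|il] := leqP l i; first by rewrite h // scale0r mem0v.
apply/memvZ/memv_span; rewrite (tnth_nth 0) -(nth_take 0 il) mem_nth //.
by rewrite size_takel // size_tuple.
Qed.

Lemma enters_flag_ofP x k :
  reflect (coord v k x != 0 /\ forall i, (k < i)%N -> coord v i x = 0)
          (enters (flag_of v) k x).
Proof.
apply: (iffP andP) => [[/mem_flag_of xk /negP xk']|[xk0 xk]]; split.
- apply/eqP => xk0; apply: xk'; apply/mem_flag_of => [|i]; first exact: ltnW.
  rewrite leq_eqVlt => /predU1P[/val_inj <- //|ki]; exact: xk.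
- by move=> i; apply: xk.
- exact/mem_flag_of.
- apply: contra xk0 => /mem_flag_of h; apply/eqP/h => //; exact: ltnW.
Qed.

Lemma enters_tnth k : enters (flag_of v) k (tnth v k).
Proof.
apply/enters_flag_ofP; rewrite coord_tnth eqxx oner_eq0; split=> // i ki.
by rewrite coord_tnth; have [ik|//] := eqVneq k i; rewrite ik ltnn in ki.
Qed.

(** Applied to conjugate bases: the coordinate of [x] at the index where it
    enters the flag reappears, up to a nonzero factor, in [M *m x] at the image
    of this index. *)
Lemma coord_monomial (M : 'M[C]_n) w d x k :
  (forall i, M *m tnth v i = d i *: tnth v (w i)) ->
  coord v (w k) (M *m x) = d k * coord v k x.
Proof.
move=> Mv; rewrite {1}(coord_expand x) mulmx_sumr linear_sum /=.
rewrite (bigD1 k) //= -scalemxAr Mv !linearZ /= coord_tnth eqxx mulr1.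
rewrite big1 ?addr0 1?mulrC // => i ik.
by rewrite -scalemxAr Mv !linearZ /= coord_tnth (inj_eq perm_inj) (negPf ik) !mulr0.
Qed.

End Basis.

Lemma vimgE (g : 'M[C]_n) U x : g \in unitmx ->
  (x \in vimg g U) = (invmx g *m x \in U).
Proof.
move=> ug; apply/idP/idP => [/memv_imgP[y yU ->]|xU].
  by rewrite lfunE /= mulKmx.
by rewrite -[x](mulKVmx ug) -[g *m _](lfunE (mulmx g)) memv_img.
Qed.

Lemma dim_vimg (g : 'M[C]_n) U : g \in unitmx -> \dim (vimg g U) = \dim U.
Proof.
move=> ug; apply: limg_dim_eq; apply/eqP; rewrite -subv0; apply/subvP => x.
case/memv_capP=> _; rewrite memv_ker lfunE /= memv0 => /eqP gx0.
by rewrite -[x](mulKmx ug) gx0 mulmx0.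
Qed.

Lemma part_act (g : 'M[C]_n) F l : part (flag_act g F) l = vimg g (part F l).
Proof. by rewrite /part ffunE. Qed.

Lemma flags_act (g : 'M[C]_n) F :
  g \in unitmx -> flags C n F -> flags C n (flag_act g F).
Proof.
move=> ug [dimF subF fF]; split=> [k|k l kl|]; rewrite !ffunE.
- by rewrite dim_vimg.
- exact/limgS/subF.
- by rewrite fF; apply/vspaceP => x; rewrite vimgE // !memvf.
Qed.

Lemma enters_act (g : 'M[C]_n) F x k : g \in unitmx ->
  enters (flag_act g F) k (g *m x) = enters F k x.
Proof. by move=> ug; rewrite /enters !part_act !vimgE // mulKmx. Qed.

Definition act_tuple (g : 'M[C]_n) v : n.-tuple 'cV[C]_n :=
  [tuple of map (mulmx g) v].

Lemma tnth_act g v k : tnth (act_tuple g v) k = g *m tnth v k.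
Proof. by rewrite tnth_map. Qed.

Lemma act_flag_of (g : 'M[C]_n) v : flag_act g (flag_of v) = flag_of (act_tuple g v).
Proof.
apply/ffunP => k; rewrite !ffunE /vimg limg_span map_take; congr <<take k _>>%VS.
by apply: eq_map => x; rewrite lfunE.
Qed.

Lemma act_basis (g : 'M[C]_n) v :
  g \in unitmx -> basis_of fullv v -> basis_of fullv (act_tuple g v).
Proof.
move=> ug bv; apply: (proj1 (flag_of_enters (flags_act ug (flag_of_basis bv)) _)).
by move=> k; rewrite tnth_act enters_act // enters_tnth.
Qed.

Lemma basis_transitive v v' : basis_of fullv v -> basis_of fullv v' ->
  exists2 g : 'M[C]_n, g \in unitmx & act_tuple g v = v'.
Proof.
pose mx (u : n.-tuple 'cV[C]_n) := \matrix_(i, j) tnth u j i 0 : 'M[C]_n.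
have mx_delta (u : n.-tuple 'cV[C]_n) j : mx u *m delta_mx j 0 = tnth u j :> 'cV[C]_n.
  by apply/matrixP => i i'; rewrite ord1 -colE !mxE.
have umx (u : n.-tuple 'cV[C]_n) : basis_of fullv u -> mx u \in unitmx.
  move=> bu; pose N := \matrix_(i, j) coord u i (delta_mx j 0 : 'cV[C]_n) : 'M[C]_n.
  suff /mulmx1_unit[] : mx u *m N = 1%:M by [].
  apply/matrixP => i j; rewrite !mxE.
  have := congr1 (fun z : 'cV[C]_n => z i 0) (coord_expand bu (delta_mx j 0)).
  rewrite summxE mxE eqxx andbT => ->.
  by apply: eq_bigr => k _; rewrite !mxE mulrC.
move=> bv bv'; exists (mx v' *m invmx (mx v)).
  by rewrite unitmx_mul unitmx_inv !umx.
apply: eq_from_tnth => k; rewrite tnth_act -(mx_delta v) mulmxA.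
by rewrite mulmxKV ?umx // mx_delta.
Qed.
End Bases.

(** * The hermitian form and the involution delta *)

Section Form.
Variables (C : numClosedFieldType) (n : nat) (eps : 'I_n -> int).
Implicit Types (x y z : 'cV[C]_n) (U V : {vspace 'cV[C]_n}) (a : C).

Lemma phiDr x y z : phi eps x (y + z) = phi eps x y + phi eps x z.
Proof. by rewrite /phi mulmxDr mxE. Qed.

Lemma phiZr a x y : phi eps x (a *: y) = a * phi eps x y.
Proof. by rewrite /phi -scalemxAr mxE. Qed.

Lemma phi_conj x y : (phi eps x y)^* = phi eps y x.
Proof.
rewrite !phiE rmorph_sum; apply: eq_bigr => k _.
by rewrite !rmorphM /= conjCK rmorph_int mulrC mulrA (mulrAC _ (x k 0)) -mulrA.
Qed.

Lemma phi_real x : phi eps x x \is Num.real.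
Proof. by apply/CrealP/phi_conj. Qed.

Lemma phiDl x y z : phi eps (x + y) z = phi eps x z + phi eps y z.
Proof. by rewrite -phi_conj phiDr rmorphD /= !phi_conj. Qed.

Lemma phiZl a x y : phi eps (a *: x) y = a^* * phi eps x y.
Proof. by rewrite -phi_conj phiZr rmorphM /= !phi_conj. Qed.

Lemma phi0r x : phi eps x 0 = 0.
Proof. by rewrite -(scale0r 0) phiZr mul0r. Qed.

Lemma phi0l x : phi eps 0 x = 0.
Proof. by rewrite -phi_conj phi0r rmorph0. Qed.

Lemma phi_sumr (I : Type) (r : seq I) (P : pred I) x (f : I -> 'cV[C]_n) :
  phi eps x (\sum_(i <- r | P i) f i) = \sum_(i <- r | P i) phi eps x (f i).
Proof. by apply: (big_morph (phi eps x)) => [y z|]; rewrite ?phiDr ?phi0r. Qed.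

Lemma phi_eq0C x y : phi eps x y = 0 -> phi eps y x = 0.
Proof. by move=> xy; rewrite -phi_conj xy rmorph0. Qed.

Lemma phi_line x y z : x \in <[y]>%VS -> phi eps z y = 0 -> phi eps z x = 0.
Proof. by case/vlineP=> a -> zy; rewrite phiZr zy mulr0. Qed.

Lemma phi_span (s : seq 'cV[C]_n) x z :
  x \in <<s>>%VS -> (forall y, y \in s -> phi eps z y = 0) -> phi eps z x = 0.
Proof.
move=> xs zs; have : (<<s>> <= dag eps <[z]>)%VS.
  apply/span_subvP => y ys; apply/mem_dag => u uz; apply: phi_eq0C.
  by apply: phi_line uz _; apply/phi_eq0C/zs.
by move/subvP/(_ x xs)/mem_dag; apply; apply: memv_line.
Qed.

End Form.

(** The standard inner product is the form of the constant sign vector 1, so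
    that the results on hermitian forms apply to it. *)
Notation dot := (phi (fun=> 1%R)).

Section Dot.
Variables (C : numClosedFieldType) (n : nat).
Implicit Types (x y : 'cV[C]_n).

Lemma dot_ge0 x : 0 <= dot x x.
Proof.
rewrite phiE sumr_ge0 // => i _; rewrite mulr1 mulrC.
exact: mul_conjC_ge0.
Qed.

Lemma dot_eq0 x : dot x x = 0 -> x = 0.
Proof.
rewrite phiE => h; apply/matrixP => i j; rewrite ord1 mxE.
move: h; under eq_bigr => k _ do rewrite mulr1 mulrC.
move/eqP; rewrite psumr_eq0 => [/allP/(_ i)|k _]; last exact: mul_conjC_ge0.
by rewrite mem_index_enum mul_conjC_eq0 => /(_ isT)/eqP.
Qed.

Lemma dot_gt0 x : x != 0 -> 0 < dot x x.
Proof.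
move=> x0; rewrite lt0r dot_ge0 andbT.
by apply: contraNneq x0 => /dot_eq0 ->.
Qed.

End Dot.

Section Delta.
Variables (C : numClosedFieldType) (n : nat) (eps : 'I_n -> int).
Hypothesis heps : sign_vector eps.
Implicit Types (x y : 'cV[C]_n).
Local Notation delta := (Phi C eps).

Lemma PhiE x k : (delta *m x) k 0 = (eps k)%:~R * x k 0.
Proof. by rewrite mul_diag_mx !mxE. Qed.

Lemma sign_sqr k : (eps k)%:~R * (eps k)%:~R = 1 :> C.
Proof. by case: (heps k) => ->; rewrite ?mulrNN mulr1. Qed.

Lemma PhiK x : delta *m (delta *m x) = x.
Proof. by apply/matrixP => k j; rewrite ord1 !PhiE mulrA sign_sqr mul1r. Qed.

Lemma Phi_mul1 : delta *m delta = 1%:M.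
Proof.
apply/matrixP => i j; have := PhiK (delta_mx j 0); rewrite mulmxA => /matrixP/(_ i 0).
by rewrite -colE !mxE eqxx andbT.
Qed.

Lemma unit_Phi : delta \in unitmx.
Proof. by have [] := mulmx1_unit Phi_mul1. Qed.

Lemma inv_Phi : invmx delta = delta.
Proof. by rewrite -[LHS]mulmx1 -Phi_mul1 mulKmx // unit_Phi. Qed.

(** The identity linking delta to phi, on which the comparison between the
    orbits of the two groups relies. *)
Lemma phi_dot x y : phi eps x y = dot (delta *m x) y.
Proof.
rewrite !phiE; apply: eq_bigr => k _.
by rewrite PhiE rmorphM /= rmorph_int mulr1 [X in X * _]mulrC.
Qed.

Lemma dot_Phi x y : dot (delta *m x) (delta *m y) = dot x y.
Proof.
rewrite !phiE; apply: eq_bigr => k _.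
by rewrite !PhiE rmorphM /= rmorph_int !mulr1 mulrACA sign_sqr mul1r.
Qed.

Lemma phi_nondeg x : (forall y, phi eps x y = 0) -> x = 0.
Proof.
move/(_ (delta *m x)); rewrite phi_dot => /dot_eq0 h.
by rewrite -(PhiK x) h mulmx0.
Qed.

Lemma eps_sum_support (P : pred 'I_n) x :
  (x \in (\sum_(k < n | P k) <[delta_mx k ord0]>)%VS) <->
  (forall k, ~~ P k -> x k 0 = 0).
Proof.
split=> [/memv_sumP[f fP ->] k Pk|h].
  rewrite summxE big1 // => i Pi; have /vlineP[a ->] := fP i Pi.
  by rewrite !mxE; case: eqP Pi => [<-|_ _]; rewrite ?(negPf Pk) // mulr0.
have -> : x = \sum_(k < n | P k) x k 0 *: delta_mx k ord0.
  apply/matrixP => i j; rewrite ord1 summxE.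
  under eq_bigr => k _ do rewrite !mxE eqxx andbT.
  have [Pi|Pi] := boolP (P i).
    rewrite (bigD1 i) //= eqxx mulr1 big1 ?addr0 // => k /andP[_ ki].
    by rewrite eq_sym (negPf ki) mulr0.
  rewrite h // big1 // => k Pk; case: eqP Pk => [<-|_ _]; last by rewrite mulr0.
  by rewrite (negPf Pi).
apply: memv_suml => k Pk; apply: (subvP (sumv_sup k Pk (subvv _))).
exact/memvZ/memv_line.
Qed.

Lemma mem_delta_eigen (s : int) x :
  (x \in (\sum_(k < n | eps k == s) <[delta_mx k ord0]>)%VS) <->
  delta *m x = s%:~R *: x.
Proof.
rewrite eps_sum_support; split=> [h|h k ek].
  apply/matrixP => k j; rewrite ord1 PhiE mxE.
  by have [->//|/h ->] := eqVneq (eps k) s; rewrite !mulr0.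
have /eqP := congr1 (fun y : 'cV[C]_n => y k 0) h; rewrite PhiE mxE.
rewrite -subr_eq0 -mulrBl mulf_eq0 subr_eq0 eqr_int (negPf ek) => /eqP //.
Qed.

Lemma mem_Vplus x : x \in Vplus C eps <-> delta *m x = (1 : int)%:~R *: x.
Proof. exact: mem_delta_eigen. Qed.

Lemma mem_Vminus x : x \in Vminus C eps <-> delta *m x = (-1 : int)%:~R *: x.
Proof. exact: mem_delta_eigen. Qed.

End Delta.

(** * Signed involutions and their invariants *)

Section SignedInvolutions.
Variable n : nat.
Implicit Types (we : 'S_n * {ffun 'I_n -> int}) (k j : 'I_n) (l m : nat) (s : int).

(** With this factor the conditions at fixed points and at exchanged pairs
    become a single formula, both for conjugate and for dual bases. *)
Definition coef we k : int := if we.1 k == k then we.2 k else 1.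

(** An exchanged pair contributes one dimension of each sign, which is counted
    when its second element is reached. *)
Definition closes we s k :=
  (we.1 k == k) && (we.2 k == s) || (we.1 k < k)%N.

Definition rank_count (w : 'S_n) m l : nat :=
  #|[set j : 'I_n | (j < l)%N && (w j < m)%N]%SET|.

Lemma invol_perm (w : 'S_n) : (w ^+ 2)%g = 1%g -> involutive w.
Proof. by move=> w2 k; rewrite -permM -expg2 w2 perm1. Qed.

Lemma coef_sqr we k : signed_involution we -> coef we k * coef we k = 1.
Proof.
case=> _ /(_ k); rewrite /coef; case: eqP => // _ [] ->; first by rewrite mulr1.
by rewrite mulrNN mulr1.
Qed.

Lemma coef_invol we k : signed_involution we -> coef we (we.1 k) = coef we k.
Proof.
move=> sw; rewrite /coef (invol_perm sw.1) [k == _]eq_sym.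
by case: eqP => // ->.
Qed.

Lemma card_lt_sum l (P : pred 'I_n) :
  #|[set k : 'I_n | (k < l)%N && P k]%SET| = (\sum_(k < n | (k < l)%N) P k)%N.
Proof.
rewrite -sum1_card big_mkcond [RHS]big_mkcond /=; apply: eq_bigr => k _.
by rewrite inE; case: (k < l)%N => //=; case: (P k).
Qed.

Lemma pq_invE we l : pq_inv we l =
  (#|[set k : 'I_n | (k < l)%N && closes we 1 k]%SET|,
   #|[set k : 'I_n | (k < l)%N && closes we (-1) k]%SET|).
Proof.
rewrite /pq_inv !card_lt_sum -!big_split /=.
by congr (_, _); apply: eq_bigr => k _; rewrite /closes; case: eqP => [->|_] /=;
  rewrite ?ltnn ?addn0 ?orbF ?add0n.
Qed.

Lemma count_step (P Q : pred 'I_n) :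
  (forall l, (l <= n)%N -> #|[set k : 'I_n | (k < l)%N && P k]%SET| =
     #|[set k : 'I_n | (k < l)%N && Q k]%SET|) -> P =1 Q.
Proof.
move=> PQ k; apply/eqP; have := PQ k.+1 (ltn_ord k); rewrite !card_lt_sum.
rewrite (bigD1 k) ?ltnSn //= [RHS](bigD1 k) ?ltnSn //=.
have sub (R : pred 'I_n) : (\sum_(i < n | (i < k.+1)%N && (i != k)) R i)%N =
   #|[set i : 'I_n | (i < k)%N && R i]%SET|.
  by rewrite card_lt_sum; apply: eq_bigl => i; rewrite ltnS [(i < k)%N]ltn_neqAle andbC.
rewrite !sub PQ; last exact: ltnW.
by move/addIn; case: (P k) (Q k) => [] [].
Qed.

(** Successive differences of the counts isolate one index at a time: those of
    the rank counts give the permutation, and then those of the signatures give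
    the signs at its fixed points. *)
Lemma invariants_inj we we' : signed_involution we -> signed_involution we' ->
  (forall m l, (m <= n)%N -> (l <= n)%N ->
     rank_count we.1 m l = rank_count we'.1 m l) ->
  (forall l, (l <= n)%N -> pq_inv we l = pq_inv we' l) -> we = we'.
Proof.
move: we we' => [w e] [w' e'] [/= w2 eP] [/= w2' eP'] rk pq.
have ww' : w = w'.
  apply/permP => k; have cmp m : (m <= n)%N -> (w k < m)%N = (w' k < m)%N.
    by move=> mn; apply: (count_step (fun l => rk m l mn)).
  apply/val_inj/eqP; rewrite eqn_leq; apply/andP; split.
    by rewrite -ltnS cmp ?ltn_ord ?ltnSn.
  by rewrite -ltnS -cmp ?ltn_ord ?ltnSn.
subst w'; congr (_, _); apply/ffunP => k.
have := eP k; have := eP' k; case: eqP => [wk|_ -> -> //].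
have := count_step (P := closes (w, e) 1) (Q := closes (w, e') 1) _ k.
rewrite /closes /= wk eqxx ltnn !orbF => h hk' hk.
have {}h : (e k == 1) = (e' k == 1).
  by apply: h => l ln; have := pq l ln; rewrite !pq_invE => -[].
by move: h; case: hk hk' => -> [] ->.
Qed.

Lemma card_perm_lt (w : 'S_n) m :
  (m <= n)%N -> #|[set k : 'I_n | (w k < m)%N]%SET| = m.
Proof.
move=> mn; rewrite -(card_imset _ (@perm_inj _ w)).
have -> : (w @: [set k : 'I_n | (w k < m)%N])%SET = [set k : 'I_n | (k < m)%N]%SET.
  apply/setP => k; rewrite inE; apply/imsetP/idP => [[j]|km].
    by rewrite inE => jm ->.
  by exists (w^-1 k)%g; rewrite ?inE permKV.
by rewrite -sum1dep_card (big_ord_narrow mn) sum1_card card_ord.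
Qed.

End SignedInvolutions.

(** * Relative positions of conjugate and dual flags *)

Section Invariants.
Variables (C : numClosedFieldType) (n : nat) (eps : 'I_n -> int).
Hypothesis heps : sign_vector eps.
Implicit Types (F : preflag C n) (x y z : 'cV[C]_n) (U : {vspace 'cV[C]_n}).
Implicit Types (v : n.-tuple 'cV[C]_n) (we : 'S_n * {ffun 'I_n -> int}).
Implicit Types (k j : 'I_n) (l m : nat) (s : int).
Local Notation delta := (Phi C eps).

Lemma conjugate_basisP we v : conjugate_basis C eps we v <->
  basis_of fullv v /\
  forall k, delta *m tnth v k = (coef we k)%:~R *: tnth v (we.1 k).
Proof.
rewrite /coef; split=> -[bv h]; split=> // k; have := h k.
  by case: eqP => [wk|wk] [h1 h2]; [rewrite h1 ?wk | rewrite h2 // mulr1z scale1r].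
by case: eqP => [wk ->|wk ->]; split=> // _; rewrite ?wk ?mulr1z ?scale1r.
Qed.

Lemma dual_basisP we v : dual_basis C eps we v <->
  basis_of fullv v /\
  forall k j, phi eps (tnth v k) (tnth v j) =
              if j == we.1 k then (coef we k)%:~R else 0.
Proof.
rewrite /coef; split=> -[bv h]; split=> // k j; have := h k j.
  case=> h1 h2 h3; have [jk|jk] := eqVneq j (we.1 k).
    have [wk|/eqP wk] := eqVneq (we.1 k) k; first by rewrite h1 // jk.
    by rewrite h2 // jk.
  by rewrite h3 // => wk; rewrite wk eqxx in jk.
move=> hk; split=> [wk jk|wk jk|/eqP wk]; rewrite hk.
- by rewrite wk jk !eqxx.
- by rewrite wk eqxx; case: eqP.
- by rewrite eq_sym (negPf wk).
Qed.

Lemma coef_neq0 we k : signed_involution we -> (coef we k)%:~R != 0 :> C.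
Proof.
move=> sw; have := coef_sqr k sw; rewrite intr_eq0; apply: contra_eq_neq => ->.
by rewrite mulr0 eq_sym oner_eq0.
Qed.

Lemma part_delta F l x : (x \in part (flag_delta eps F) l) = (delta *m x \in part F l).
Proof. by rewrite part_act vimgE ?inv_Phi ?unit_Phi. Qed.

Lemma part_dag F l : (l <= n)%N -> part (flag_dag eps F) l = dag eps (part F (n - l)).
Proof.
move=> ln; rewrite /part ffunE; congr (dag eps (F _)); apply: val_inj => /=.
by rewrite !inordK ?subSS // ltnS leq_subr.
Qed.

Section Conjugate.
Variables (we : 'S_n * {ffun 'I_n -> int}) (v : n.-tuple 'cV[C]_n).
Hypotheses (sw : signed_involution we) (cv : conjugate_basis C eps we v).
Let bv : basis_of fullv v := proj1 (proj1 (conjugate_basisP we v) cv).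
Let dv := proj2 (proj1 (conjugate_basisP we v) cv).
Let wK := invol_perm (proj1 sw).

(** A vector entering at [k] has nonzero coordinate there, hence its image has
    nonzero coordinate at [we.1 k], and can lie in the [m]-th term only if
    [we.1 k < m]. *)
Lemma conjugate_rank m l : (m <= n)%N -> (l <= n)%N ->
  \dim (part (flag_delta eps (flag_of v)) m :&: part (flag_of v) l)%VS =
  rank_count we.1 m l.
Proof.
move=> mn ln; rewrite capvC; apply: dim_part_cap => // [|k]; first exact: flag_of_basis.
apply: (iffP idP) => [km|[x]].
  exists (tnth v k); last exact: enters_tnth.
  rewrite part_delta dv memvZ // (enters_mem (flag_of_basis bv) (enters_tnth bv _)) //.
rewrite part_delta => /(mem_flag_of bv _ mn) xm /(enters_flag_ofP bv)[xk0 _].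
rewrite ltnNge; apply/negP => /xm; rewrite (coord_monomial bv _ _ dv).
by apply/eqP/mulf_neq0 => //; apply: coef_neq0.
Qed.

(** An eigenvector has coordinates of equal size at [k] and [we.1 k], so it
    cannot enter at the first element of a pair; at the second one,
    [v_k + s * v_(w k)] does. *)
Lemma conjugate_eigen s U l : s = 1 \/ s = -1 -> (l <= n)%N ->
  (forall x, x \in U <-> delta *m x = s%:~R *: x) ->
  \dim (part (flag_of v) l :&: U)%VS =
  #|[set k : 'I_n | (k < l)%N && closes we s k]%SET|.
Proof.
move=> hs ln Us; apply: dim_part_cap => // [|k]; first exact: flag_of_basis.
have ss : s%:~R * s%:~R = 1 :> C.
  by case: hs => ->; rewrite ?mulrNN mulr1.
apply: (iffP orP) => [[/andP[/eqP wk /eqP ek]|wk]|[x /Us xU]].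
- exists (tnth v k); last exact: enters_tnth.
  by apply/Us; rewrite dv /coef wk eqxx ek.
- exists (1 *: tnth v k + s%:~R *: tnth v (we.1 k)).
    apply/Us; rewrite scale1r mulmxDr -scalemxAr !dv coef_invol // wK.
    rewrite /coef; case: eqP wk => [->|_ wk]; first by rewrite ltnn.
    by rewrite mulr1z !scale1r scalerDr scalerA ss scale1r addrC.
  apply: entersD => //; [exact: flag_of_basis|exact: oner_neq0|exact: enters_tnth|].
  by rewrite memvZ // (enters_mem (flag_of_basis bv) (enters_tnth bv _)) // ltnW.
move=> /(enters_flag_ofP bv)[xk0 xk].
have := coord_monomial bv x k dv; rewrite xU linearZ /=.
case: (ltngtP (we.1 k) k) => [_ _|kw|/val_inj wk].
- by right.
- rewrite xk // mulr0 => /esym/eqP; rewrite mulf_eq0 (negPf xk0) orbF => h.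
  by have := coef_neq0 k sw; rewrite h.
- rewrite wk => /(mulIf xk0)/eqP; rewrite /coef wk eqxx eqr_int => /eqP ->.
  by left; rewrite eqxx.
Qed.

End Conjugate.

Section Dual.
Variables (we : 'S_n * {ffun 'I_n -> int}) (v : n.-tuple 'cV[C]_n).
Hypotheses (sw : signed_involution we) (dv : dual_basis C eps we v).
Let bv : basis_of fullv v := proj1 (proj1 (dual_basisP we v) dv).
Let phiv := proj2 (proj1 (dual_basisP we v) dv).
Let wK := invol_perm (proj1 sw).

Lemma phi_dual k x :
  phi eps (tnth v k) x = coord v (we.1 k) x * (coef we k)%:~R.
Proof.
rewrite {1}(coord_expand bv x) phi_sumr (bigD1 (we.1 k)) //= phiZr phiv eqxx.
by rewrite big1 ?addr0 // => i ik; rewrite phiZr phiv (negPf ik) mulr0.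
Qed.

(** Orthogonality to the first vectors of a dual basis is the vanishing of the
    coordinates at the images of their indices. *)
Lemma mem_dag_dual x l : (l <= n)%N ->
  reflect (forall k, (k < l)%N -> coord v (we.1 k) x = 0)
          (x \in dag eps (part (flag_of v) l)).
Proof.
move=> ln; apply: (iffP idP) => [/mem_dag h k kl|h].
  have vk : tnth v k \in part (flag_of v) l.
    by rewrite (enters_mem (flag_of_basis bv) (enters_tnth bv _)).
  by apply: (mulIf (coef_neq0 k sw)); rewrite mul0r -phi_dual h.
apply/mem_dag => y /(mem_flag_of bv _ ln) yl; apply: phi_eq0C.
rewrite (coord_expand bv y) phi_sumr big1 // => k _; rewrite phiZr.
have [kl|lk] := ltnP k l; last by rewrite yl // mul0r.
by rewrite (phi_eq0C (y := x)) ?mulr0 // phi_dual h // mul0r.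
Qed.

Lemma dual_rank m l : (m <= n)%N -> (l <= n)%N ->
  \dim (part (flag_dag eps (flag_of v)) m :&: part (flag_of v) l)%VS =
  rank_count (we.1 * w0 n)%g m l.
Proof.
move=> mn ln; rewrite capvC part_dag //.
apply: dim_part_cap => // [|k]; first exact: flag_of_basis.
have -> : ((we.1 * w0 n)%g k < m)%N = (n - m <= we.1 k)%N.
  rewrite permM permE /= -(ltn_add2r (we.1 k).+1) subnK ?ltn_ord //.
  by rewrite leq_subLR addnS ltnS.
apply: (iffP idP) => [km|[x /mem_dag_dual]].
  exists (tnth v k); last exact: enters_tnth.
  apply/mem_dag_dual => [|j jm]; first exact: leq_subr.
  rewrite coord_tnth //; have [kj|//] := eqVneq k (we.1 j).
  by move: km; rewrite kj wK leqNgt jm.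
move=> /(_ (leq_subr _ _)) xm /(enters_flag_ofP bv)[xk0 _].
rewrite leqNgt; apply: contra xk0 => km; have := xm _ km.
by rewrite wK => ->.
Qed.

Lemma flags_dag_dual : flags C n (flag_dag eps (flag_of v)).
Proof.
have fv := flag_of_basis bv.
split=> [k|k l kl|]; last by rewrite ffunE; apply/vspaceP=> x; rewrite memvf;
  apply/mem_dag => y; rewrite partE /= subnn part0 // memv0 => /eqP ->; apply: phi0l.
  have kn : (k <= n)%N by rewrite -ltnS.
  have := dual_rank kn (leqnn n); rewrite part_full // capvf -partE => ->.
  rewrite -[RHS](card_perm_lt (we.1 * w0 n)%g kn); apply: eq_card => j.
  by rewrite !inE ltn_ord.
rewrite [flag_dag _ _ k]ffunE [flag_dag _ _ l]ffunE.
apply/subvP => x /mem_dag h; apply/mem_dag => y yl; apply: h.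
by case: fv => _ sub _; apply: (subvP (sub _ _ _) y yl); rewrite /= leq_sub2l.
Qed.

End Dual.
End Invariants.

(** * Signatures *)

Section Signature.
Variables (C : numClosedFieldType) (n : nat).
Implicit Types (eps : 'I_n -> int) (x y z : 'cV[C]_n) (U V : {vspace 'cV[C]_n}).
Implicit Types (s b : seq 'cV[C]_n).

(** Changing the sign of the form exchanges the two indices of a signature, so
    that only positive definite subspaces need be studied. *)
Definition opp_sign eps : 'I_n -> int := fun k => - eps k.

Lemma phi_opp eps x y : phi (opp_sign eps) x y = - phi eps x y.
Proof.
rewrite !phiE -sumrN; apply: eq_bigr => k _.
by rewrite rmorphN /= mulrN mulNr.
Qed.

Lemma dag_opp eps U : dag (opp_sign eps) U = dag eps U.
Proof.
apply/vspaceP => y; apply/idP/idP => /mem_dag h; apply/mem_dag => x /h.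
  by rewrite phi_opp => /eqP; rewrite oppr_eq0 => /eqP.
by rewrite phi_opp => ->; rewrite oppr0.
Qed.

Lemma is_signature_opp eps U p q :
  is_signature eps U (p, q) -> is_signature (opp_sign eps) U (q, p).
Proof.
case=> b [fb b0 bU orth [-> ->]]; exists b; rewrite dag_opp; split=> //.
  by move=> i j ib jb ij; rewrite phi_opp orth // oppr0.
by congr (_, _); apply: eq_count => x /=; rewrite phi_opp ?oppr_gt0 ?oppr_lt0.
Qed.

Definition orthogonal_seq eps s := {in s &, forall x y, x != y -> phi eps x y = 0}.

Lemma phi_orthogonal_span eps s x : free s -> orthogonal_seq eps s ->
  x \in <<s>>%VS -> exists k, x = \sum_(y <- s) k y *: y /\
    phi eps x x = \sum_(y <- s) (k y)^* * k y * phi eps y y.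
Proof.
move=> fs orth xs; have [k kx _] := free_span fs xs; exists k; split=> //.
rewrite {2}kx phi_sumr [LHS]big_seq [RHS]big_seq; apply: eq_bigr => y ys.
rewrite phiZr -mulrA mulrCA; congr (_ * _); rewrite -phi_conj {1}kx phi_sumr.
rewrite (bigD1_seq y) ?free_uniq //= phiZr rmorphD rmorphM /= phi_conj big_seq_cond.
rewrite big1 ?rmorph0 ?addr0 // => z /andP[zs zy].
by rewrite phiZr orth ?mulr0 // eq_sym.
Qed.

Section Inertia.
Variables (eps : 'I_n -> int) (U : {vspace 'cV[C]_n}) (p q : nat).
Hypothesis sU : is_signature eps U (p, q).

(** A positive definite subspace meets trivially the span of the remaining
    vectors of an orthogonal basis, on which the form is nonpositive. *)
Lemma positive_dim_le V : (V <= U)%VS ->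
  (forall x, x \in V -> x != 0 -> 0 < phi eps x x) -> (\dim V <= p)%N.
Proof.
case: sU => b [fb b0 bU orth [pE _]] VU Vpos.
have ub := free_uniq fb; set rad := (U :&: dag eps U)%VS in b0 bU.
have orthb : orthogonal_seq eps b.
  move=> _ _ /(nthP 0)[i ib <-] /(nthP 0)[j jb <-] ij; apply: orth => //.
  by apply: contraNneq ij => ->.
pose pos := [pred x : 'cV[C]_n | 0 < phi eps x x].
pose bp := filter pos b; pose bn := filter (predC pos) b.
have defb : (<<b>> = <<bp>> + <<bn>>)%VS.
  rewrite -span_cat; apply: eq_span => x; rewrite mem_cat !mem_filter.
  by rewrite -andb_orl orbN.
have bn_le0 x : x \in (<<bn>> + rad)%VS -> phi eps x x <= 0.
  case/memv_addP => y yb [r /memv_capP[rU /mem_dag rd] ->].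
  have yU : y \in U by rewrite -bU defb; apply: (subvP (addvSl _ _)); apply: (subvP (addvSr _ _)).
  rewrite phiDl !phiDr (phi_eq0C (rd y yU)) (rd y yU) (rd r rU) !addr0.
  have [||k [_ ->]] := @phi_orthogonal_span eps _ _ _ _ yb; first exact: filter_free.
    by move=> z t; rewrite !mem_filter => /andP[_ zb] /andP[_ tb]; apply: orthb.
  rewrite big_seq sumr_le0 // => z; rewrite mem_filter => /andP[/= zn _].
  rewrite mulr_ge0_le0 //; first by rewrite mulrC mul_conjC_ge0.
  by rewrite real_leNgt ?phi_real ?real0.
have cap0 : (V :&: (<<bn>> + rad) = 0)%VS.
  apply/eqP; rewrite -subv0; apply/subvP => x /memv_capP[xV /bn_le0 xn].
  rewrite memv0; apply: contraLR isT => x0; have := lt_le_trans (Vpos x xV x0) xn.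
  by rewrite ltxx.
have sub : (<<bn>> + rad <= U)%VS by rewrite -bU defb -addvA addvSr.
have : (\dim V + \dim (<<bn>> + rad) <= p + \dim (<<bn>> + rad))%N.
  rewrite -dimv_disjoint_sum // pE -size_filter.
  apply: (@leq_trans (\dim U)); first by rewrite dimvS // subv_add VU.
  rewrite -[in leqLHS]bU defb -addvA.
  by apply: leq_trans (dimv_add_leqif _ _) _; rewrite leq_add2r dim_span.
by rewrite leq_add2r.
Qed.

Lemma positive_dim_ex : exists V, [/\ (V <= U)%VS, \dim V = p &
  forall x, x \in V -> x != 0 -> 0 < phi eps x x].
Proof.
case: sU => b [fb b0 bU orth [pE _]]; pose pos := [pred x : 'cV[C]_n | 0 < phi eps x x].
have ub := free_uniq fb; have fbp : free (filter pos b) by apply: filter_free.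
exists <<filter pos b>>%VS; split.
- apply: subv_trans (sub_span _) _; first by move=> x; rewrite mem_filter => /andP[_ h]; exact: h.
  by rewrite -[X in (_ <= X)%VS]bU addvSl.
- by move/eqP: fbp => ->; rewrite size_filter.
move=> x xb x0; have [|k [xE ->]] := @phi_orthogonal_span eps _ _ fbp _ xb.
  move=> y z; rewrite !mem_filter => /andP[_ /(nthP 0)[i ib <-]] /andP[_ /(nthP 0)[j jb <-]].
  by move=> ij; apply: orth => //; apply: contraNneq ij => ->.
have term y : y \in filter pos b -> 0 <= (k y)^* * k y * phi eps y y.
  rewrite mem_filter => /andP[/= /ltW y0 _].
  by rewrite mulr_ge0 // mulrC mul_conjC_ge0.
rewrite lt0r big_seq sumr_ge0 // andbT; apply: contraNneq x0 => /eqP.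
rewrite psumr_eq0 // => /allP h; rewrite xE big_seq big1 // => y yb.
have := h y yb; rewrite yb /= mulf_eq0 => /orP[|/eqP y0].
  by rewrite mulrC mul_conjC_eq0 => /eqP ->; rewrite scale0r.
by move: yb; rewrite mem_filter /= y0 ltxx.
Qed.

End Inertia.

Lemma negative_dim_le eps U p q V : is_signature eps U (p, q) -> (V <= U)%VS ->
  (forall x, x \in V -> x != 0 -> phi eps x x < 0) -> (\dim V <= q)%N.
Proof.
move=> /is_signature_opp sU VU Vneg; apply: (positive_dim_le sU) => // x xV x0.
by rewrite phi_opp oppr_gt0 Vneg.
Qed.

(** Sylvester's law of inertia: each index is the largest dimension of a
    definite subspace of the corresponding sign. *)
Lemma is_signature_uniq eps U pq pq' :
  is_signature eps U pq -> is_signature eps U pq' -> pq = pq'.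
Proof.
have half e a c a' c' : is_signature e U (a, c) -> is_signature e U (a', c') -> (a <= a')%N.
  move=> /positive_dim_ex[V [VU <- Vpos]] s'; exact: positive_dim_le s' _ _ _.
case: pq pq' => [p q] [p' q'] s s'; have s1 := is_signature_opp s; have s1' := is_signature_opp s'.
by congr (_, _); apply/eqP; rewrite eqn_leq; apply/andP; split;
  [exact: half s s'|exact: half s' s|exact: half s1 s1'|exact: half s1' s1].
Qed.

Lemma signatureE eps U pq : is_signature eps U pq -> signature eps U = pq.
Proof. by move=> s; apply: xget_unique => // pq' s'; apply: is_signature_uniq s' s. Qed.

(** An orthogonal family of anisotropic vectors is automatically free and
    independent of the radical, so only its span is left to check. *)
Lemma is_signature_family eps U (I : finType) (A : {set I}) (u : I -> 'cV[C]_n) :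
  {in A &, forall i j, i != j -> phi eps (u i) (u j) = 0} ->
  {in A, forall i, phi eps (u i) (u i) != 0} ->
  {in A, forall i, u i \in U} ->
  (U <= <<[seq u i | i <- enum A]>> + (U :&: dag eps U))%VS ->
  is_signature eps U (#|[set i in A | 0 < phi eps (u i) (u i)]%SET|,
                      #|[set i in A | phi eps (u i) (u i) < 0]%SET|).
Proof.
move=> orth aniso uU sub; pose b := [seq u i | i <- enum A].
have inA i : i \in enum A -> i \in A by rewrite mem_enum.
have fb : free b.
  rewrite /b; elim: (enum A) (enum_uniq A) inA => [|i r IHr] /= => [_ _|/andP[ir ur] rA].
    exact: nil_free.
  rewrite free_cons IHr // ?andbT; last by move=> j jr; apply: rA; rewrite inE jr orbT.
  apply/negP => ur'; move/negP: (aniso i (rA i (mem_head _ _))); apply; apply/eqP.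
  apply: phi_span ur' _ => _ /mapP[j jr ->]; apply: orth; rewrite ?rA ?mem_head ?inE ?jr ?orbT //.
  by apply: contraNneq ir => ->.
exists b; split=> //.
- apply/eqP; rewrite -subv0; apply/subvP => z /memv_capP[zb /memv_capP[_ /mem_dag zd]].
  have [k zE _] := free_span fb zb; rewrite memv0 zE big_seq big1 // => y yb.
  have /mapP[i /inA iA yE] := yb; move: (zd y); rewrite yE uU // => /(_ isT).
  rewrite {1}zE phi_sumr (bigD1_seq y) ?free_uniq //= big_seq_cond big1.
    rewrite addr0 yE phiZr => /eqP.
    by rewrite mulf_eq0 (negPf (aniso i iA)) orbF => /eqP->; rewrite scale0r.
  move=> t /andP[/mapP[j /inA jA ->] ty]; rewrite phiZr orth ?mulr0 //.
  by apply: contraNneq ty => <-; rewrite yE.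
- apply/eqP; rewrite eqEsubv sub andbT subv_add capvSl andbT.
  by apply/span_subvP => _ /mapP[i /inA iA ->]; apply: uU.
- move=> i j; rewrite !size_map => ib jb ij.
  have [i0 _] : exists i0 : I, true by case: (enum A) ib => // a; exists a.
  rewrite !(nth_map i0) // orth ?inA ?mem_nth //.
  by rewrite nth_uniq ?enum_uniq.
by congr (_, _); rewrite count_map -sum1_count big_enum_cond /= -sum1_card;
  apply: eq_bigl => i; rewrite inE.
Qed.

End Signature.

(** * Signatures of dual flags *)

Section DualSignature.
Variables (C : numClosedFieldType) (n : nat) (eps : 'I_n -> int).
Hypothesis heps : sign_vector eps.
Variables (we : 'S_n * {ffun 'I_n -> int}) (v : n.-tuple 'cV[C]_n).
Hypotheses (sw : signed_involution we) (dv : dual_basis C eps we v).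
Implicit Types (k j : 'I_n) (l m : nat).
Let bv : basis_of fullv v := proj1 (proj1 (dual_basisP eps we v) dv).
Let phiv := proj2 (proj1 (dual_basisP eps we v) dv).
Let wK := invol_perm (proj1 sw).

(** In the hyperbolic plane of an exchanged pair, the sum and the difference of
    the two isotropic vectors are orthogonal, of squares 2 and -2.  The sum is
    placed at the second index of the pair, where the pair is counted. *)
Definition split_pair k : 'cV[C]_n :=
  if we.1 k == k then tnth v k
  else if (we.1 k < k)%N then tnth v k + tnth v (we.1 k)
  else tnth v k - tnth v (we.1 k).

Let sgn k : C := if we.1 k == k then 0 else if (we.1 k < k)%N then 1 else -1.

Lemma split_pairE k : split_pair k = tnth v k + sgn k *: tnth v (we.1 k).
Proof.
rewrite /split_pair /sgn; case: ifP => _; first by rewrite scale0r addr0.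
by case: ifP => _; rewrite ?scale1r // scaleN1r.
Qed.

Lemma phi_split_pair k j : phi eps (split_pair k) (split_pair j) =
  if j == k then (if we.1 k == k then (we.2 k)%:~R
                  else if (we.1 k < k)%N then 2 else - 2) else 0.
Proof.
have sgn_conj i : (sgn i)^* = sgn i.
  rewrite /sgn; case: ifP => _; first exact: conjC0.
  case: ifP => _; first exact: conjC1.
  by rewrite raddfN; congr (- _); apply: conjC1.
have phic i i' : phi eps (tnth v i) (tnth v i') =
  (i' == we.1 i)%:R * (if we.1 i == i then (we.2 i)%:~R else 1).
  by rewrite phiv /coef; case: eqP; case: eqP; rewrite ?mul1r ?mul0r.
rewrite !split_pairE !(phiDl, phiDr, phiZl, phiZr) sgn_conj !phic wK.
have [->|jk] := eqVneq j k.
  rewrite !eqxx [k == _]eq_sym.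
  have [wk|wk] := eqVneq (we.1 k) k; first by rewrite /sgn wk eqxx !mul0r !addr0 !mul1r.
  rewrite /sgn ?wK ?[k == _]eq_sym (negPf wk) ?mul1r ?mul0r ?mulr0 ?add0r ?addr0 ?mulr1.
  by case: ifP => _; rewrite ?mulN1r -?opprD.
have [jw|jw] := eqVneq j (we.1 k).
  have /negPf wk : we.1 k != k by rewrite -jw.
  have kw : (k == we.1 k) = false by rewrite eq_sym.
  rewrite jw !wK !eqxx wk kw !mul0r !mulr0 !mul1r add0r addr0.
  rewrite /sgn wK kw wk.
  case: (ltngtP (we.1 k) k) => [_|_|/val_inj wkk]; last by rewrite wkk eqxx in wk.
    by rewrite ?mul1r ?mulr1 addrN.
  by rewrite ?mul1r ?mulr1 addrN.
have wjk : (we.1 j == k) = false by apply: contraNF jw => /eqP <-; rewrite wK.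
by rewrite wjk (inj_eq perm_inj) (negPf jk) !mul0r !mulr0 !addr0.
Qed.

(** A vector of the dual basis below [l] whose partner is not below [l] is in
    the radical; the others are recovered from their orthogonal versions. *)
Lemma dual_signature l : (l <= n)%N ->
  is_signature eps (part (flag_of v) l) (pq_inv we l).
Proof.
move=> ln; pose A := [set k : 'I_n | (k < l)%N && (we.1 k < l)%N]%SET.
have memv k : (tnth v k \in part (flag_of v) l) = (k < l)%N.
  by rewrite (enters_mem (flag_of_basis bv) (enters_tnth bv _)).
have memA k : (k \in A) = (k < l)%N && (we.1 k < l)%N by rewrite inE.
have wA k : k \in A -> we.1 k \in A by rewrite !memA wK andbC.
have := @is_signature_family _ _ eps (part (flag_of v) l) _ A split_pair.
have fixed k : we.1 k == k -> we.2 k = 1 \/ we.2 k = -1 by case: sw => _ /(_ k); case: ifP.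
rewrite pq_invE; set pq1 := (_, _); set pq2 := (_, _); have <- : pq1 = pq2; last first.
  apply=> [k j _ _ kj|k _|k kA|].
  - by rewrite phi_split_pair eq_sym (negPf kj).
  - rewrite phi_split_pair eqxx; case: ifP => [/fixed[] ->|_].
    + by rewrite oner_neq0.
    + by rewrite mulrN1z oppr_eq0 oner_neq0.
    + by case: ifP; rewrite ?oppr_eq0 pnatr_eq0.
  - have /andP[kl wkl] : (k < l)%N && (we.1 k < l)%N by rewrite -memA.
    by rewrite split_pairE memvD ?memvZ ?memv.
  apply/subvP => x /(mem_flag_of bv _ ln) xl; rewrite (coord_expand bv x).
  apply: memv_suml => k _; have [lk|kl] := leqP l k.
    by rewrite xl // scale0r mem0v.
  apply: memvZ.
  have [wkl|lwk] := ltnP (we.1 k) l; last first.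
    apply: (subvP (addvSr _ _)); rewrite memv_cap memv kl /=.
    apply/(mem_dag_dual sw dv) => // j jl; rewrite coord_tnth //.
    by have [kj|//] := eqVneq k (we.1 j); rewrite kj wK leqNgt jl in lwk.
  apply: (subvP (addvSl _ _)).
  have kA : k \in A by rewrite memA kl.
  have memu j : j \in A -> split_pair j \in <<[seq split_pair i | i <- enum A]>>%VS.
    by move=> jA; apply/memv_span/map_f; rewrite mem_enum.
  have half (y z : 'cV[C]_n) : y = 2^-1 *: ((y + z) + (y - z)).
    by rewrite addrACA subrr addr0 -mulr2n -scaler_nat scalerA mulVf ?scale1r // pnatr_eq0.
  have := memu k kA; have := memu _ (wA k kA).
  rewrite /split_pair wK [k == _]eq_sym.
  case: eqP => // wk.
  case: (ltngtP (we.1 k) k) => [_|_|/val_inj //] u1 u2;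
    rewrite (half (tnth v k) (tnth v (we.1 k))); apply/memvZ/memvD => //.
    by rewrite -opprB memvN.
  by rewrite addrC.
have pos2 : 0 < 2 :> C by rewrite ltr0n.
have neg2 : (0 < - 2 :> C) = false by rewrite oppr_gt0 lt_gtF.
rewrite /pq1 /pq2; congr (_, _).
  apply: eq_card => k; rewrite !inE phi_split_pair eqxx /closes.
  have [kl|//] := boolP (k < l)%N; have [wk|wk] := eqVneq (we.1 k) k.
    rewrite wk kl ltnn orbF; have [|->|->] := fixed k; first exact/eqP.
      by rewrite ltr01.
    by rewrite ltr0N1.
  case: (ltngtP (we.1 k) k) => [wkk|kw|/val_inj wkk]; last by rewrite wkk eqxx in wk.
    by rewrite (ltn_trans wkk kl) pos2.
  by rewrite neg2 andbF.
(* The negative vector of a pair sits at its first index, whereas the pair is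
   counted at its second one: apply the involution. *)
rewrite -(card_imset _ (@perm_inj _ we.1)); apply: eq_card => k.
rewrite -{1}(wK k) mem_imset; last exact: perm_inj.
rewrite !inE phi_split_pair eqxx /closes wK [(we.1 k < l)%N && _]andbC.
have [kl|//] := boolP (k < l)%N; rewrite [k == _]eq_sym.
have [wk|wk] := eqVneq (we.1 k) k.
  rewrite wk kl ltnn orbF; have [|->|->] := fixed k; first exact/eqP.
    by rewrite ltr10.
  by rewrite ltrN10.
case: (ltngtP (we.1 k) k) => [wkk|kw|/val_inj wkk]; last by rewrite wkk eqxx in wk.
  by rewrite (ltn_trans wkk kl) oppr_lt0 pos2.
by rewrite lt_gtF ?andbF.
Qed.

End DualSignature.

(** * Existence of conjugate bases *)

Section Classification.
Variables (C : numClosedFieldType) (n : nat) (eps : 'I_n -> int).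
Hypothesis heps : sign_vector eps.
Implicit Types (F : preflag C n) (x y z : 'cV[C]_n).
Implicit Types (i j k m : 'I_n).
Local Notation delta := (Phi C eps).

Lemma delta_neq0 x : x != 0 -> delta *m x != 0.
Proof. by apply: contraNneq => h; rewrite -(PhiK heps x) h mulmx0. Qed.

(** An eigenvector at each fixed point and one vector of each pair suffice: the
    second vector of a pair is the image of the first. *)
Lemma conjugate_of_half F (w : 'I_n -> 'I_n) (y : 'I_n -> 'cV[C]_n) :
  flags C n F -> involutive w -> (forall k, enters F k (y k)) ->
  (forall k, w k = k -> exists2 s : int, s = 1 \/ s = -1 & delta *m y k = s%:~R *: y k) ->
  (forall k, w k <> k -> enters F (w k) (delta *m y k)) ->
  exists we, let v := [tuple if (k <= w k)%N then y k else delta *m y (w k) | k < n] in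
    [/\ signed_involution we, conjugate_basis C eps we v & F = flag_of v].
Proof.
move=> fF wK ey yfix ymove.
have [s sP] : {s : 'I_n -> int & forall k, if w k == k
    then (s k = 1 \/ s k = -1) /\ delta *m y k = (s k)%:~R *: y k else s k = 0}.
  apply: (@boolp.choice _ _ (fun k (c : int) => if w k == k
    then (c = 1 \/ c = -1) /\ delta *m y k = c%:~R *: y k else c = 0)) => k.
  by case: eqP => [/yfix[c c1 yc]|_]; [exists c | exists 0].
pose W : 'S_n := perm (can_inj wK).
exists (W, [ffun k => s k]); set v := [tuple _ | _ < _].
have [bv Fv] : basis_of fullv v /\ F = flag_of v.
  apply: flag_of_enters => // k; rewrite tnth_mktuple.
  case: leqP => // wk; have := ymove (w k); rewrite wK; apply=> kw.
  by rewrite -kw ltnn in wk.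
split=> //.
  split=> [|k]; first by rewrite expg2; apply/permP => k; rewrite permM !permE wK.
  by rewrite /= permE ffunE; have := sP k; case: eqP => _ // -[].
split=> // k; rewrite /= !permE ffunE !tnth_mktuple wK; split=> [wk|/eqP wk].
  by rewrite wk leqnn; have := sP k; rewrite wk eqxx => -[].
case: (ltngtP k (w k)) => [kw|wkk|/val_inj kw].
- by [].
- by rewrite PhiK.
by rewrite -kw eqxx in wk.
Qed.

(** The involution sends [k] to the earliest index at which the image under
    delta of a vector entering at [k] can enter. *)
Lemma conjugate_exists F : flags C n F ->
  exists we v, [/\ signed_involution we, conjugate_basis C eps we v & F = flag_of v].
Proof.
move=> fF; pose P k m := exists x, enters F k x /\ enters F m (delta *m x).
have [w wP] : {w : 'I_n -> 'I_n & forall k, P k (w k) /\ forall m, P k m -> (w k <= m)%N}.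
  apply: (@boolp.choice _ _ (fun k m => P k m /\ forall i, P k i -> (m <= i)%N)) => k.
  have [x ekx] := exists_enters k fF.
  have [m em] := entersP fF (delta_neq0 (enters_neq0 ekx)).
  have Pm : `[< P k m >] by apply/asboolP; exists x.
  case: (@arg_minnP _ m (fun i => `[< P k i >]) val Pm) => m' /asboolP Pm' mmin.
  by exists m'; split=> // i /asboolP; apply: mmin.
have w_le k : (w (w k) <= k)%N.
  by have [[x [ex edx]] _] := wP k; apply: (proj2 (wP (w k))); exists (delta *m x); rewrite PhiK.
have wK : involutive w.
  (* If [w (w k) < k], subtracting from [x] a multiple of [delta y], which
     enters earlier than [x], makes the image of [x] enter before [w k]. *)
  move=> k; apply/val_inj/eqP; rewrite eqn_leq w_le leqNgt; apply/negP => lt_k.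
  have [[x [ex edx]] xmin] := wP k; have [[y [ey edy]] _] := wP (w k).
  have [a ha] := enters_line fF ey (enters_part edx).
  have ex' : enters F k (1 *: x + (- a) *: (delta *m y)).
    apply: entersD => //; first exact: oner_neq0.
    by rewrite memvZ // (enters_mem fF edy) // ltnW.
  have := delta_neq0 (enters_neq0 ex').
  rewrite mulmxDr -!scalemxAr PhiK // scale1r scaleNr => d0.
  have [m [mw em]] := enters_exists fF (ltnW (ltn_ord (w k))) d0 ha.
  have : P k m.
    exists (1 *: x + (- a) *: (delta *m y)); split=> //.
    by rewrite mulmxDr -!scalemxAr PhiK // scale1r scaleNr.
  by move/xmin; rewrite leqNgt mw.
have [x xP] : {x : 'I_n -> 'cV[C]_n &
    forall k, enters F k (x k) /\ enters F (w k) (delta *m x k)}.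
  by apply: (@boolp.choice _ _ (fun k x => enters F k x /\ enters F (w k) (delta *m x)))
    => k; case: (wP k).
have [y yP] : {y : 'I_n -> 'cV[C]_n & forall k, enters F k (y k) /\ if w k == k
    then delta *m y k = y k \/ delta *m y k = - y k else y k = x k}.
  apply: (@boolp.choice _ _ (fun k y => enters F k y /\ if w k == k
    then delta *m y = y \/ delta *m y = - y else y = x k)) => k.
  have [ex edx] := xP k; case: eqP edx => [->|_] edx; last by exists (x k).
  have two0 : 2 != 0 :> C by rewrite pnatr_eq0.
  have xdx : (1 + 1 : C) *: x k = (x k + delta *m x k) + (x k - delta *m x k).
    by rewrite scalerDl scale1r addrACA addrN addr0.
  have plusP : x k + delta *m x k \in part F k.+1 by rewrite memvD ?enters_part.
  have minusP : x k - delta *m x k \in part F k.+1 by rewrite memvB ?enters_part.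
  (* The sum of x + delta x and x - delta x is 2x, which enters at k; hence so
     does one of these two eigenvectors. *)
  have [plus|plus] := boolP (x k + delta *m x k \in part F k).
    exists (x k - delta *m x k); split; last first.
      by right; rewrite mulmxBr PhiK // opprB.
    apply/andP; split=> //=; apply/negP => minus; case/andP: ex => _ /negP; apply.
    by rewrite -(scalerK two0 (x k)) xdx memvZ // memvD.
  exists (x k + delta *m x k); split; first exact/andP.
  by left; rewrite mulmxDr PhiK // addrC.
have [//|//||||we [sw cv Fv]] := @conjugate_of_half F w y.
- by move=> k; case: (yP k).
- move=> k wk; have [_] := yP k; rewrite wk eqxx => -[->|->].
    by exists 1; [left|rewrite scale1r].
  by exists (-1); [right|rewrite mulrNz scaleNr scale1r].
- by move=> k /eqP wk; have [_] := yP k; rewrite (negPf wk) => ->; case: (xP k).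
by eexists we, _; split; [|exact: cv|].
Qed.

End Classification.

(** * Existence of dual bases *)

Section HermitianReduction.
Variables (C : numClosedFieldType) (n : nat) (eps : 'I_n -> int).
Hypothesis heps : sign_vector eps.
Variables (F : preflag C n) (fF : flags C n F).
Implicit Types (x y z : 'cV[C]_n) (i j k m : 'I_n) (S : {set 'I_n}).
Implicit Types (w : 'S_n) (v : 'I_n -> 'cV[C]_n).

(** The state of the reduction: the vectors indexed by [S] satisfy the duality
    relations among themselves and are orthogonal to all the others, while [v]
    remains adapted to the flag. *)
Definition reduced S w v :=
  [/\ involutive w, forall k, k \notin S -> w k = k,
      forall k, enters F k (v k) &
      forall k, k \in S ->
        (forall j, j != w k -> phi eps (v k) (v j) = 0) /\
        if w k == k then phi eps (v k) (v k) = 1 \/ phi eps (v k) (v k) = -1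
        else phi eps (v k) (v (w k)) = 1].

Section Step.
Variables (S : {set 'I_n}) (w : 'S_n) (v : 'I_n -> 'cV[C]_n) (k : 'I_n).
Hypotheses (red : reduced S w v) (kS : k \notin S).
Hypothesis kmin : forall j, (j < k)%N -> j \in S.

Let wK : involutive w. Proof. by case: red. Qed.
Let wS j : j \notin S -> w j = j. Proof. by case: red => _ + _ _; apply. Qed.
Let ev j : enters F j (v j). Proof. by case: red => _ _ + _; apply. Qed.

Let wS_in j : j \in S -> w j \in S.
Proof.
move=> jS; apply/negPn/negP => wjS; move: (wS wjS); rewrite wK => jw.
by rewrite -jw jS in wjS.
Qed.

Let orthS j i : j \in S -> i \notin S -> phi eps (v j) (v i) = 0.
Proof.
move=> jS iS; case: red => _ _ _ /(_ j jS)[+ _]; apply.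
by apply: contraNneq iS => ->; apply: wS_in.
Qed.

Let orthS' j i : j \in S -> i \notin S -> phi eps (v i) (v j) = 0.
Proof. by move=> jS iS; apply/phi_eq0C/orthS. Qed.

Let k_lt j : j \notin S -> j != k -> (k < j)%N.
Proof.
move=> jS jk; rewrite ltn_neqAle eq_sym jk leqNgt.
by apply: contra jS => /kmin.
Qed.

Let vk_part j : j \notin S -> j != k -> v k \in part F j.
Proof. by move=> jS jk; rewrite (enters_mem fF (ev k)) ?k_lt // ltnW. Qed.

(** The projection of a later vector along [v k] subtracts a multiple of an
    earlier vector, so it preserves the flag; vectors already treated are
    orthogonal to [v k] and do not change. *)
Lemma reduce_anisotropic : phi eps (v k) (v k) != 0 ->
  exists v', reduced (k |: S)%SET w v'.
Proof.
set c := phi eps (v k) (v k) => c0.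
pose a j := if j == k then (sqrtC `|c|)^-1 else 1.
pose b j := if j == k then 0 else - (phi eps (v k) (v j) / c).
have wk := wS kS.
exists (fun j => a j *: v j + b j *: v k).
have bS j : j \in S -> b j = 0.
  move=> jS; rewrite /b; case: eqP => // _.
  by rewrite orthS' // mul0r oppr0.
have aS j : j \in S -> a j = 1.
  by move=> jS; rewrite /a; case: eqP jS => // ->; rewrite (negPf kS).
have c_norm : `|c| != 0 by rewrite normr_eq0.
have a0 j : a j != 0.
  by rewrite /a; case: ifP => _; rewrite ?oner_neq0 // invr_eq0 sqrtC_eq0.
have kphi j : j != k -> phi eps (v k) (a j *: v j + b j *: v k) = 0.
  move=> jk; rewrite phiDr !phiZr /a /b (negPf jk) mul1r mulNr divfK //.
  by rewrite addrN.
split=> // [j|j|j].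
- by rewrite !inE negb_or => /andP[_ /wS].
- apply: entersD => //; have [jS|jS] := boolP (j \in S); first by rewrite bS // scale0r mem0v.
  have [->|jk] := eqVneq j k; first by rewrite /b eqxx scale0r mem0v.
  by rewrite memvZ // vk_part.
rewrite !inE => /predU1P[->|jS].
  rewrite wk eqxx; split=> [i ik|].
    by rewrite /b eqxx scale0r addr0 phiZl kphi // mulr0.
  rewrite /b eqxx scale0r addr0 phiZl phiZr -/c /a eqxx.
  have s0 : 0 <= (sqrtC `|c|)^-1 by rewrite invr_ge0 sqrtC_ge0.
  rewrite (CrealP (ger0_real s0)) mulrA -expr2 exprVn sqrtCK.
  have [cp|cn] := real_ge0P (phi_real eps (v k)); first by left; rewrite mulVf.
  by right; rewrite invrN mulNr mulVf.
case: red => _ _ _ /(_ j jS)[orth norm]; rewrite aS // bS // scale1r scale0r addr0.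
have same i : phi eps (v j) (a i *: v i + b i *: v k) = phi eps (v j) (v i).
  rewrite phiDr !phiZr (orthS jS kS) mulr0 addr0 /a; case: eqP => [->|_].
    by rewrite (orthS jS kS) mulr0.
  by rewrite mul1r.
split=> [i iw|]; first by rewrite same orth.
by rewrite same.
Qed.

(** The partner of an isotropic vector is the first [v m] not orthogonal to it.
    By minimality of [m], the vectors between [k] and [m] are corrected by
    multiples of [v k] only, so that the flag is preserved. *)
Lemma reduce_hyperbolic : phi eps (v k) (v k) = 0 ->
  exists m v', reduced (k |: (m |: S))%SET (w * tperm k m)%g v'.
Proof.
move=> kk; have wk := wS kS.
have [m0 km0] : exists m, phi eps (v k) (v m) != 0.
  apply: contrapT => h; have /negP := enters_neq0 (ev k); apply; apply/eqP.
  apply: (phi_nondeg heps) => y; have [|b _] := @flag_of_enters _ _ F [tuple v j | j < n] fF.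
    by move=> j; rewrite tnth_mktuple.
  rewrite (coord_expand b y) phi_sumr big1 // => j _; rewrite tnth_mktuple phiZr.
  by have [->|kj] := eqVneq (phi eps (v k) (v j)) 0; [rewrite mulr0|case: h; exists j].
case: (@arg_minnP _ m0 (fun i => phi eps (v k) (v i) != 0) val km0) => m km mmin.
have mS : m \notin S by apply: contraNN km => mS; rewrite orthS'.
have mk : m != k by apply: contraNneq km => ->; rewrite kk.
have ltkm := k_lt mS mk; have wm := wS mS.
pose t := phi eps (v k) (v m); pose u1 := t^-1 *: v m.
(* The multiple of v k making u isotropic; c is real. *)
pose c := phi eps u1 u1; pose u := u1 - (c / 2) *: v k.
have ku1 : phi eps (v k) u1 = 1 by rewrite phiZr mulVf.
have uE : u = u1 + - (c / 2) *: v k by rewrite scaleNr.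
have ku : phi eps (v k) u = 1 by rewrite uE phiDr ku1 phiZr kk mulr0 addr0.
have uk : phi eps u (v k) = 1 by rewrite -phi_conj ku conjC1.
have uu : phi eps u u = 0.
  rewrite {2}uE phiDr [phi eps u (_ *: v k)]phiZr uk mulr1 uE phiDl
    [phi eps (_ *: v k) u1]phiZl ku1 mulr1 -/c.
  have cR : - (c / 2) \is Num.real by rewrite rpredN rpredM ?phi_real // rpredV realn.
  by rewrite (CrealP cR) -addrA -opprD -splitr subrr.
pose v' j := if j == k then v k else if j == m then u else
  1 *: v j + (- phi eps u (v j) *: v k - phi eps (v k) (v j) *: u).
have v'k : v' k = v k by rewrite /v' eqxx.
have v'm : v' m = u by rewrite /v' (negPf mk) eqxx.
have v'S j : j \in S -> v' j = v j.
  move=> jS; rewrite /v'; case: eqP jS => [->|_ jS]; first by rewrite (negPf kS).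
  case: eqP jS => [->|_ jS]; first by rewrite (negPf mS).
  rewrite (orthS' jS kS) /u phiDl /u1 phiZl -scaleNr phiZl !orthS' // !mulr0 addr0.
  by rewrite oppr0 !scale0r oppr0 !addr0 scale1r.
have kv' j : phi eps (v k) (v' j) = (j == m)%:R.
  rewrite /v'; case: (eqVneq j k) => [->|jk]; first by rewrite kk eq_sym (negPf mk).
  case: eqP => // _; rewrite !phiDr -[- (_ *: u)]scaleNr !phiZr kk ku mulr0 add0r.
  by rewrite mul1r mulr1 addrN.
have uv' j : phi eps u (v' j) = (j == k)%:R.
  rewrite /v'; case: (eqVneq j k) => // jk; case: eqP => // _.
  rewrite !phiDr -[- (_ *: u)]scaleNr !phiZr uk uu mulr0 addr0.
  by rewrite mul1r mulr1 addrN.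
have Sv' j i : j \in S -> phi eps (v j) (v' i) = phi eps (v j) (v i).
  move=> jS; have ju : phi eps (v j) u = 0.
    by rewrite phiDr -scaleNr !phiZr !orthS // !mulr0 addr0.
  rewrite /v'; case: eqP => [->//|_]; case: eqP => [->|_]; first by rewrite ju orthS.
  by rewrite !phiDr -[- (_ *: u)]scaleNr !phiZr ju (orthS jS kS) !mulr0 !addr0 mul1r.
exists m, v'.
have w'S j : j \in S -> (w * tperm k m)%g j = w j.
  move=> /wS_in wjS; rewrite permM tpermD //.
    by apply: contraNneq kS => ->.
  by apply: contraNneq mS => ->.
have w'k : (w * tperm k m)%g k = m by rewrite permM wk tpermL.
have w'm : (w * tperm k m)%g m = k by rewrite permM wm tpermR.
have w'o j : j \notin S -> j != k -> j != m -> (w * tperm k m)%g j = j.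
  by move=> jS jk jm; rewrite permM wS // tpermD // eq_sym.
split=> [j|j|j|j].
- have [->|jk] := eqVneq j k; first by rewrite w'k w'm.
  have [->|jm] := eqVneq j m; first by rewrite w'm w'k.
  have [jS|jS] := boolP (j \in S); last by rewrite !w'o.
  by rewrite !w'S ?wS_in.
- by rewrite !inE !negb_or => /and3P[jk jm jS]; apply: w'o.
- rewrite /v'; have [->//|jk] := eqVneq j k; have [->|jm] := eqVneq j m.
    rewrite /u /u1 -scaleNr; apply: entersD => //; first by rewrite invr_eq0.
    by rewrite memvZ // (enters_mem fF (ev k)) // ltnW.
  have [jS|jS] := boolP (j \in S).
    by move: (v'S j jS); rewrite /v' (negPf jk) (negPf jm) => ->.
  apply: entersD => //; first exact: oner_neq0.
  have vkj : v k \in part F j by apply: vk_part.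
  apply: memvB; first exact: memvZ.
  have [->|/mmin mj] := eqVneq (phi eps (v k) (v j)) 0; first by rewrite scale0r mem0v.
  have {}mj : (m < j)%N by rewrite ltn_neqAle mj andbT eq_sym.
  apply: memvZ; apply: memvB; apply: memvZ => //.
  by rewrite (enters_mem fF (ev m)) // ltnW.
rewrite !inE => /or3P[/eqP->|/eqP->|jS].
- by rewrite w'k v'k (negPf mk) kv' eqxx; split=> // i /negPf im; rewrite kv' im.
- rewrite w'm v'm eq_sym (negPf mk) uv' eqxx; split=> // i /negPf ik.
  by rewrite uv' ik.
rewrite w'S // v'S //; case: red => _ _ _ /(_ j jS)[orth norm].
by split=> [i iw|]; rewrite !Sv' // orth.
Qed.

End Step.

Lemma reduce_all S w v : reduced S w v -> exists w' v', reduced [set: 'I_n]%SET w' v'.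
Proof.
have [N] := ubnP #|(~: S)%SET|; elim: N S w v => // N IHN S w v; rewrite ltnS => SN red.
have [ST|] := eqVneq (~: S)%SET finset.set0.
  by exists w, v; rewrite -(finset.setCK S) ST finset.setC0 in red.
case/set0Pn => k0; rewrite inE => k0S.
case: (@arg_minnP _ k0 (fun i => i \notin S) val k0S) => k kS kmin0.
have kmin j : (j < k)%N -> j \in S.
  by apply: contraTT => /kmin0; rewrite -leqNgt.
have card_lt (T : {set 'I_n}) : (S \subset T)%SET -> k \in T -> (#|(~: T)%SET| < N)%N.
  move=> ST kT; apply: leq_trans SN; apply/proper_card/properP; split.
    by rewrite finset.setCS.
  by exists k; rewrite inE // kT.
have [kk|kk] := eqVneq (phi eps (v k) (v k)) 0.
  have [m [v' red']] := reduce_hyperbolic red kS kmin kk.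
  apply: IHN red'; apply: card_lt; last by rewrite !inE eqxx.
  by apply/fintype.subsetP => j jS; rewrite !inE jS !orbT.
have [v' red'] := reduce_anisotropic red kS kmin kk.
apply: IHN red'; apply: card_lt; last by rewrite !inE eqxx.
exact: finset.subsetUr.
Qed.

Lemma dual_exists :
  exists we (u : n.-tuple 'cV[C]_n),
    [/\ signed_involution we, dual_basis C eps we u & F = flag_of u].
Proof.
have [v0 v0P] : {v : 'I_n -> 'cV[C]_n & forall k, enters F k (v k)}.
  by apply: (@boolp.choice _ _ (fun k => enters F k)) => k; apply: exists_enters.
have [|w [v [wK _ ev vP]]] := @reduce_all finset.set0 1%g v0.
  by split=> // [k|k|k]; rewrite ?perm1 // inE.
pose we := (w, [ffun k => if w k == k then
                  (if phi eps (v k) (v k) == 1 then 1 else -1) else 0]) : 'S_n * {ffun 'I_n -> int}.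
have [|bv Fv] := @flag_of_enters _ _ F [tuple v k | k < n] fF.
  by move=> k; rewrite tnth_mktuple.
exists we, [tuple v k | k < n]; split=> //.
  split=> [|k]; first by rewrite expg2; apply/permP => k; rewrite permM perm1 wK.
  by rewrite /= ffunE; case: (w k == k) => //; case: (_ == 1); [left|right].
apply/dual_basisP; split=> // k j; rewrite !tnth_mktuple /coef /= ffunE.
have [orth norm] := vP k (finset.in_setT k).
have [->|/orth//] := eqVneq j (w k); case: eqP norm => [->|_ -> //].
by case=> ->; rewrite ?eqxx // eqNr oner_eq0.
Qed.

End HermitianReduction.

(** * Incidence between conjugate and dual flags *)

Section Matching.
Variables (C : numClosedFieldType) (n : nat) (eps : 'I_n -> int).
Hypothesis heps : sign_vector eps.
Implicit Types (F : preflag C n) (x y z : 'cV[C]_n) (i j k : 'I_n) (l m : nat).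
Implicit Types (v u : n.-tuple 'cV[C]_n) (we : 'S_n * {ffun 'I_n -> int}).
Local Notation delta := (Phi C eps).

Definition orthonormal_tuple v := forall k j, dot (tnth v k) (tnth v j) = (j == k)%:R.

Lemma orthonormal_coord v k x :
  orthonormal_tuple v -> basis_of fullv v -> dot (tnth v k) x = coord v k x.
Proof.
move=> ov bv; rewrite {1}(coord_expand bv x) phi_sumr (bigD1 k) //= phiZr ov eqxx.
by rewrite mulr1 big1 ?addr0 // => i ik; rewrite phiZr ov (negPf ik) mulr0.
Qed.

Lemma orthonormal_basis v : orthonormal_tuple v -> basis_of fullv v.
Proof.
move=> ov; rewrite basisEfree size_tuple dim_fullv leqnn andbT subvf andbT.
apply/freeP => a a0 k; have := congr1 (dot (tnth v k)) a0.
rewrite phi0r phi_sumr (bigD1 k) //= -tnth_nth phiZr ov eqxx mulr1.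
by rewrite big1 ?addr0 // => i ik; rewrite -tnth_nth phiZr ov (negPf ik) mulr0.
Qed.

(** Gram-Schmidt, as the reduction of the form with all signs 1: for a definite
    form, no vector of the dual basis is isotropic, which leaves only fixed
    points of sign 1. *)
Lemma orthonormal_exists F : flags C n F ->
  exists u, [/\ orthonormal_tuple u, basis_of fullv u & F = flag_of u].
Proof.
have h1 : sign_vector (fun _ : 'I_n => 1 : int) by left.
move=> /(dual_exists h1)[we [u [[w2 eP] /dual_basisP[bu du] Fu]]].
exists u; split=> // k j.
have pos i : 0 < dot (tnth u i) (tnth u i).
  by apply/dot_gt0/(basis_not0 bu); rewrite mem_tnth.
have wk : we.1 k = k.
  by apply/eqP; have := pos k; rewrite du; case: (eqVneq k (we.1 k)) => //; rewrite ltxx.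
have := pos k; rewrite !du wk /coef wk eqxx; have := eP k; rewrite wk eqxx.
by case=> ->; [case: eqP | rewrite ltr0N1].
Qed.

(** For a conjugate basis, the form is read on the inner products, since
    phi(x, y) is the inner product of delta x and y. *)
Lemma conjugate_orthonormal_dual we v :
  orthonormal_tuple v -> conjugate_basis C eps we v -> dual_basis C eps we v.
Proof.
move=> ov /conjugate_basisP[bv dv]; apply/dual_basisP; split=> // k j.
rewrite phi_dot dv phiZl ov rmorph_int.
by case: (j == we.1 k); rewrite ?mulr1 ?mulr0.
Qed.

(** If [x = delta y] with [y] in the [m]-th term and [x] orthogonal to this
    term, then [<x, x> = phi(y, x) = 0]. *)
Lemma delta_dag_disjoint F m x :
  x \in part (flag_delta eps F) m -> x \in dag eps (part F m) -> x = 0.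
Proof.
rewrite part_delta // => dx /mem_dag/(_ _ dx).
by rewrite phi_dot PhiK // => /dot_eq0.
Qed.

Lemma delta_dag_dim F m l : flags C n F -> (l <= n)%N ->
  (\dim (part (flag_delta eps F) m :&: part F l) +
   \dim (dag eps (part F m) :&: part F l) <= l)%N.
Proof.
move=> fF ln; rewrite -dimv_disjoint_sum; last first.
  apply/eqP; rewrite -subv0; apply/subvP => x.
  case/memv_capP=> /memv_capP[dx _] /memv_capP[gx _].
  by rewrite (delta_dag_disjoint dx gx) mem0v.
by rewrite -[leqRHS](dim_part fF ln) dimvS // subv_add !capvSr.
Qed.

(** Translates dimensions of intersections with orthogonals, which count the
    indices [j] with [w j] at least [m], into the complementary counts. *)
Lemma rank_count_w0 (w : 'S_n) m l : (m <= n)%N -> (l <= n)%N ->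
  (rank_count w m l + rank_count (w * w0 n)%g (n - m) l)%N = l.
Proof.
move=> mn ln; rewrite /rank_count !card_lt_sum -big_split /=.
have -> : (\sum_(k < n | (k < l)%N) ((w k < m) + ((w * w0 n)%g k < n - m)))%N =
  (\sum_(k < n | (k < l)%N) 1)%N.
  apply: eq_bigr => k _; rewrite permM permE /= ltn_sub2lE // ltnS.
  by case: ltnP.
by rewrite (big_ord_narrow ln) sum1_card card_ord.
Qed.

Section Invariants.
Variables (we : 'S_n * {ffun 'I_n -> int}) (F : preflag C n).
Hypothesis sw : signed_involution we.

Lemma conjugate_flags_rank m l : conjugate_flags C eps we F ->
  (m <= n)%N -> (l <= n)%N ->
  \dim (part (flag_delta eps F) m :&: part F l)%VS = rank_count we.1 m l.
Proof. by case=> v cv <- mn ln; apply: conjugate_rank sw cv _ _ mn ln. Qed.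

Lemma conjugate_flags_sig l : conjugate_flags C eps we F -> (l <= n)%N ->
  (\dim (part F l :&: Vplus C eps)%VS, \dim (part F l :&: Vminus C eps)%VS) =
  pq_inv we l.
Proof.
case=> v cv <- ln; rewrite pq_invE; congr (_, _).
  by apply: (conjugate_eigen sw cv _ ln); [left | apply: mem_Vplus].
by apply: (conjugate_eigen sw cv _ ln); [right | apply: mem_Vminus].
Qed.

Lemma dual_flags_rank m l : dual_flags C eps we F -> (m <= n)%N -> (l <= n)%N ->
  \dim (dag eps (part F m) :&: part F l)%VS = rank_count (we.1 * w0 n)%g (n - m) l.
Proof.
case=> v dv <- mn ln; rewrite -(dual_rank sw dv) ?leq_subr // part_dag ?leq_subr //.
by rewrite subKn.
Qed.

Lemma dual_flags_sig l : dual_flags C eps we F -> (l <= n)%N ->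
  is_signature eps (part F l) (pq_inv we l).
Proof. by case=> v dv <- ln; apply: dual_signature sw dv _ ln. Qed.

End Invariants.

Lemma conjugate_flags_flags we F : conjugate_flags C eps we F -> flags C n F.
Proof. by case=> v [bv _] <-; apply: flag_of_basis. Qed.

Lemma dual_flags_flags we F : dual_flags C eps we F -> flags C n F.
Proof. by case=> v [bv _] <-; apply: flag_of_basis. Qed.

Lemma Vplus_pos x : x \in Vplus C eps -> x != 0 -> 0 < phi eps x x.
Proof. by move=> /mem_Vplus xV x0; rewrite phi_dot xV scale1r dot_gt0. Qed.

Lemma Vminus_neg x : x \in Vminus C eps -> x != 0 -> phi eps x x < 0.
Proof.
by move=> /mem_Vminus xV x0; rewrite phi_dot xV mulrNz scaleN1r -scaleN1r phiZl
  rmorphN1 mulN1r oppr_lt0 dot_gt0.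
Qed.

(** Comparison of the invariants of the two kinds of orbits through a common
    flag; it orients all the incidences in the same direction. *)
Lemma conjugate_dual_le we we' F : signed_involution we -> signed_involution we' ->
  conjugate_flags C eps we F -> dual_flags C eps we' F ->
  (forall m l, (m <= n)%N -> (l <= n)%N ->
     (rank_count we.1 m l <= rank_count we'.1 m l)%N) /\
  (forall l, (l <= n)%N -> ((pq_inv we l).1 <= (pq_inv we' l).1)%N /\
                           ((pq_inv we l).2 <= (pq_inv we' l).2)%N).
Proof.
move=> sw sw' cF dF; split=> [m l mn ln|l ln].
  have := delta_dag_dim m (conjugate_flags_flags cF) ln.
  rewrite (conjugate_flags_rank sw cF mn ln) (dual_flags_rank sw' dF mn ln).
  by rewrite -[leqRHS](rank_count_w0 we'.1 mn ln) leq_add2r.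
rewrite -(conjugate_flags_sig sw cF ln).
have := dual_flags_sig sw' dF ln; case: (pq_inv we' l) => p q s /=; split.
  apply: (positive_dim_le s); first exact: capvSl.
  by move=> x /memv_capP[_ xV]; apply: Vplus_pos.
apply: (negative_dim_le s); first exact: capvSl.
by move=> x /memv_capP[_ xV]; apply: Vminus_neg.
Qed.

Lemma conjugate_flags_inj we we' F : signed_involution we -> signed_involution we' ->
  conjugate_flags C eps we F -> conjugate_flags C eps we' F -> we = we'.
Proof.
move=> sw sw' cF cF'; apply: invariants_inj => // [m l mn ln|l ln].
  by rewrite -(conjugate_flags_rank sw cF) // (conjugate_flags_rank sw' cF').
by rewrite -(conjugate_flags_sig sw cF) // (conjugate_flags_sig sw' cF').
Qed.

(** The two intersections are disjoint, and for a common signed involution their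
    dimensions add up to [l]. *)
Lemma conjugate_dual_split we F : signed_involution we ->
  conjugate_flags C eps we F -> dual_flags C eps we F ->
  forall m l x, (m <= n)%N -> (l <= n)%N -> x \in part F l ->
  exists a b, [/\ x = a + b, a \in part (flag_delta eps F) m, a \in part F l,
    b \in dag eps (part F m) & b \in part F l].
Proof.
move=> sw cF dF m l x mn ln xl; have fF := conjugate_flags_flags cF.
have cap0 : ((part (flag_delta eps F) m :&: part F l) :&:
             (dag eps (part F m) :&: part F l) = 0)%VS.
  apply/eqP; rewrite -subv0; apply/subvP => y.
  case/memv_capP=> /memv_capP[dy _] /memv_capP[gy _].
  by rewrite (delta_dag_disjoint dy gy) mem0v.
have sumE : ((part (flag_delta eps F) m :&: part F l) +
             (dag eps (part F m) :&: part F l) = part F l)%VS.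
  apply/eqP; rewrite eqEdim subv_add !capvSr /= dimv_disjoint_sum // dim_part //.
  rewrite (conjugate_flags_rank sw cF) // (dual_flags_rank sw dF) //.
  by rewrite rank_count_w0.
move: xl; rewrite -{1}sumE => /memv_addP[a /memv_capP[a1 a2] [b /memv_capP[b1 b2] ->]].
by exists a, b.
Qed.

(** By the splitting of both [F_(k-1)] and [F_k], the projection of [u_k] to
    [delta(F_m)] is again orthogonal to [F_(k-1)], hence a multiple of [u_k]:
    for every [m], either [delta(u_k)] is in [F_m] or it is orthogonal to [F_m].
    So [delta(u_k)] is carried by the line of the orthonormal basis at the index
    where it enters the flag. *)
Lemma conjugate_dual_monomial we F u : signed_involution we ->
  conjugate_flags C eps we F -> dual_flags C eps we F ->
  orthonormal_tuple u -> basis_of fullv u -> F = flag_of u ->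
  forall k, exists j c, delta *m tnth u k = c *: tnth u j /\ c^* * c = 1.
Proof.
move=> sw cF dF ou bu Fu k.
have fF := conjugate_flags_flags cF.
have orth m a b : a \in part (flag_delta eps F) m -> b \in dag eps (part F m) -> dot a b = 0.
  rewrite part_delta // => am /mem_dag/(_ _ am).
  by rewrite phi_dot PhiK.
have ucoord := orthonormal_coord _ _ ou bu.
have line j x : x \in part F j.+1 -> (forall y, y \in part F j -> dot y x = 0) ->
    x = coord u j x *: tnth u j.
  move=> xj yx; rewrite {1}(coord_expand bu x) (bigD1 j) //= big1 ?addr0 // => i ij.
  have [lt_ij|] := ltnP i j.
    rewrite -ucoord yx ?scale0r // Fu (enters_mem (flag_of_basis bu) (enters_tnth bu i)) //.
    exact: ltnW.
  rewrite leq_eqVlt eq_sym (inj_eq val_inj) (negPf ij) /= => lt_ji.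
  by move: xj; rewrite Fu => /(mem_flag_of bu) ->; rewrite ?scale0r.
have uk_part : tnth u k \in part F k.+1 by rewrite Fu; apply/enters_part/enters_tnth.
have u_orth y : y \in part F k -> dot y (tnth u k) = 0.
  rewrite Fu => /(mem_flag_of bu) yk; apply: phi_eq0C; rewrite ucoord yk //.
  exact: ltnW.
have dichotomy m : (m <= n)%N ->
    (tnth u k \in part (flag_delta eps F) m) \/ (tnth u k \in dag eps (part F m)).
  move=> mn; have [a [b [uE am ak bm bk]]] := conjugate_dual_split sw cF dF mn (ltn_ord k) uk_part.
  have aE : a = coord u k a *: tnth u k.
    apply: line => // y yk.
    have [y1 [y2 [-> y1m y1k y2m _]]] := conjugate_dual_split sw cF dF mn (ltnW (ltn_ord k)) yk.
    rewrite phiDl (phi_eq0C (orth _ _ _ am y2m)) addr0.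
    have := u_orth _ y1k; rewrite uE phiDr (orth _ _ _ y1m bm) addr0 //.
  have bE : b = (1 - coord u k a) *: tnth u k.
    by rewrite scalerBl scale1r -aE {1}uE addrC addKr.
  have := orth _ _ _ am bm; rewrite {1}aE bE phiZl phiZr ou eqxx mulr1 => /eqP.
  rewrite mulf_eq0 conjC_eq0 => /orP[/eqP c0|/eqP c1]; [right|left].
    by move: bE; rewrite c0 subr0 scale1r => <-.
  by move/eqP: c1; rewrite subr_eq0 => /eqP c1; move: aE; rewrite -c1 scale1r => <-.
have uk0 : tnth u k != 0 by apply: (basis_not0 bu); rewrite mem_tnth.
have [j ej] := entersP fF (delta_neq0 heps uk0).
have duE : delta *m tnth u k = coord u j (delta *m tnth u k) *: tnth u j.
  apply: line; first exact: enters_part ej.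
  have [|] := dichotomy j (ltnW (ltn_ord j)).
    by rewrite part_delta // => h; case/andP: ej => _; rewrite h.
  move=> /mem_dag h y /h; rewrite phi_dot => hy.
  by rewrite -(dot_Phi heps) PhiK.
move: duE; set c := coord u j _ => duE; exists j, c; split=> //.
have := dot_Phi heps (tnth u k) (tnth u k).
by rewrite duE phiZl phiZr !ou !eqxx !mulr1.
Qed.

(** The vectors of the conjugate basis built from [u] are unit multiples of
    those of [u], so this basis is still orthonormal, hence dual. *)
Lemma conjugate_dual_basis we F : signed_involution we ->
  conjugate_flags C eps we F -> dual_flags C eps we F ->
  exists v, [/\ dual_basis C eps we v, conjugate_basis C eps we v & F = flag_of v].
Proof.
move=> sw cF dF; have fF := conjugate_flags_flags cF.
have [u [ou bu Fu]] := orthonormal_exists fF.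
have mono := conjugate_dual_monomial sw cF dF ou bu Fu.
have [w wP] : {w : 'I_n -> 'I_n & forall k, exists c,
    delta *m tnth u k = c *: tnth u (w k) /\ c^* * c = 1}.
  by apply: (@boolp.choice _ _ (fun k j => exists c,
    delta *m tnth u k = c *: tnth u j /\ c^* * c = 1)).
have [c cP] : {c : 'I_n -> C & forall k,
    delta *m tnth u k = c k *: tnth u (w k) /\ (c k)^* * c k = 1}.
  by apply: (@boolp.choice _ _ (fun k c =>
    delta *m tnth u k = c *: tnth u (w k) /\ c^* * c = 1)).
have eu k : enters F k (tnth u k) by rewrite Fu; apply: enters_tnth.
have c0 k : c k != 0.
  by apply: contra_eq_neq (proj2 (cP k)) => ->; rewrite mulr0 eq_sym oner_eq0.
have scaled k a : a != 0 -> enters F k (a *: tnth u k).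
  by move=> a0; rewrite -[_ *: _]addr0; apply: entersD; rewrite ?mem0v.
have uu k : tnth u k = (c k * c (w k)) *: tnth u (w (w k)).
  by rewrite -[LHS](PhiK heps) (cP k).1 -scalemxAr (cP (w k)).1 scalerA.
have wK : involutive w.
  move=> k; apply: (enters_uniq fF (x := tnth u k)); last exact: eu.
  by rewrite uu; apply/scaled/mulf_neq0.
have [//|//|k|k wk|k wk|we' [sw' cv Fv]] := @conjugate_of_half _ _ _ heps F w (tnth u).
- exact: eu.
- have /eqP := congr1 (coord u k) (uu k).
  rewrite linearZ /= !coord_tnth // !wk eqxx mulr1 eq_sym -expr2 sqrf_eq1.
  rewrite (cP k).1 wk => /orP[]/eqP->; first by exists 1; [left|].
  by exists (-1); [right|rewrite mulrNz].
- by rewrite (cP k).1; apply: scaled.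
set v := [tuple _ | _ < _] in cv Fv; exists v.
suff ov : orthonormal_tuple v.
  have cF' : conjugate_flags C eps we' F by exists v.
  rewrite (conjugate_flags_inj sw sw' cF cF'); split=> //.
  exact: conjugate_orthonormal_dual.
have vE k : exists2 a, tnth v k = a *: tnth u k & a^* * a = 1.
  rewrite tnth_mktuple; case: leqP => _; first by exists 1; rewrite ?scale1r // conjC1 mulr1.
  by exists (c (w k)); [rewrite (cP (w k)).1 wK | exact: proj2 (cP (w k))].
move=> k j; have [->|jk] := eqVneq j k.
  by have [a -> aa] := vE k; rewrite phiZl phiZr ou eqxx mulr1 aa.
have [a -> _] := vE k; have [b -> _] := vE j.
by rewrite phiZl phiZr ou (negPf jk) !mulr0.
Qed.

End Matching.

(** * Bases which are both conjugate and dual *)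

Section Existence.
Variables (C : numClosedFieldType) (n : nat) (eps : 'I_n -> int).
Hypothesis heps : sign_vector eps.
Implicit Types (F : preflag C n) (x y z : 'cV[C]_n) (i j k : 'I_n) (l m : nat).
Implicit Types (v u : n.-tuple 'cV[C]_n) (we : 'S_n * {ffun 'I_n -> int}).
Local Notation delta := (Phi C eps).

Lemma signature_of_conjugate we F : signed_involution we ->
  conjugate_flags C eps we F -> pq_inv we n = (\dim (Vplus C eps), \dim (Vminus C eps)).
Proof.
move=> sw cF; rewrite -(conjugate_flags_sig sw cF (leqnn n)).
by rewrite part_full ?capfv //; apply: conjugate_flags_flags cF.
Qed.

Lemma dot_delta (t : 'I_n -> 'I_n) k j :
  dot (delta_mx (t k) 0 : 'cV[C]_n) (delta_mx (t j) 0) = (t j == t k)%:R.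
Proof.
rewrite phiE (bigD1 (t k)) //= !mxE !eqxx conjC1 mulr1 mul1r andbT eq_sym.
rewrite big1 ?addr0 // => i ik; rewrite !mxE (negPf ik) conjC0 !mul0r //.
Qed.

Lemma Phi_delta k : delta *m delta_mx k 0 = (eps k)%:~R *: (delta_mx k 0 : 'cV[C]_n).
Proof.
apply/matrixP => i j; rewrite ord1 PhiE !mxE eqxx andbT.
by case: eqP => [->|_]; rewrite ?mulr0.
Qed.

(** The standard flag, whose invariants give the dimensions of [Vplus] and
    [Vminus]. *)
Lemma standard_conjugate :
  conjugate_flags C eps (1%g, finfun eps) (flag_of [tuple delta_mx k 0 | k < n]).
Proof.
exists [tuple delta_mx k 0 | k < n] => //; apply/conjugate_basisP; split.
  by apply: orthonormal_basis => k j; rewrite !tnth_mktuple (dot_delta id).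
by move=> k; rewrite /coef /= perm1 eqxx ffunE tnth_mktuple Phi_delta.
Qed.

Lemma standard_signed : signed_involution (1%g, finfun eps).
Proof. by split=> [|k]; rewrite ?expg1n //= perm1 eqxx ffunE. Qed.

Lemma dim_Vplus : \dim (Vplus C eps) = #|[set k | eps k == 1]%SET|.
Proof.
have := signature_of_conjugate standard_signed standard_conjugate.
rewrite pq_invE => -[<- _]; apply: eq_card => k.
by rewrite !inE ltn_ord /closes /= perm1 eqxx ltnn orbF ffunE.
Qed.

Lemma dim_Vminus : \dim (Vminus C eps) = #|[set k | eps k == -1]%SET|.
Proof.
have := signature_of_conjugate standard_signed standard_conjugate.
rewrite pq_invE => -[_ <-]; apply: eq_card => k.
by rewrite !inE ltn_ord /closes /= perm1 eqxx ltnn orbF ffunE.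
Qed.

Lemma dim_Vplus_Vminus : (\dim (Vplus C eps) + \dim (Vminus C eps) = n)%N.
Proof.
rewrite dim_Vplus dim_Vminus -[RHS]card_ord -[RHS](cardC [set k | eps k == 1]%SET).
congr (_ + _)%N; apply: eq_card => k; rewrite !inE.
by case: (heps k) => ->.
Qed.

(** The indices are bounded below by the dimensions of [Vplus] and [Vminus], on
    which the form is definite, and these already add up to [n]. *)
Lemma signature_of_dual we F : signed_involution we ->
  dual_flags C eps we F -> pq_inv we n = (\dim (Vplus C eps), \dim (Vminus C eps)).
Proof.
move=> sw dF; have := dual_flags_sig sw dF (leqnn n).
rewrite part_full; last exact: dual_flags_flags dF.
case: (pq_inv we n) => p q s.
have lep : (\dim (Vplus C eps) <= p)%N.
  by apply: (positive_dim_le s (subvf _)) => x; apply: Vplus_pos.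
have leq_ : (\dim (Vminus C eps) <= q)%N.
  by apply: (negative_dim_le s (subvf _)) => x; apply: Vminus_neg.
have : (p + q <= \dim (Vplus C eps) + \dim (Vminus C eps))%N.
  rewrite dim_Vplus_Vminus; case: s => b [fb _ _ _ [-> ->]].
  apply: (@leq_trans (size b)); last first.
    by move/eqP: fb => <-; rewrite -[leqRHS](dim_fullv C n) dimvS ?subvf.
  rewrite -count_predUI [X in (_ + X)%N](eq_count (a2 := pred0)) ?count_pred0 ?addn0 ?count_size //.
  by move=> x /=; apply/negP => /andP[h1 h2]; have := lt_trans h1 h2; rewrite ltxx.
move=> lepq; congr (_, _); apply/eqP; rewrite eqn_leq ?lep ?leq_ andbT.
  by rewrite -(leq_add2r q); apply: leq_trans lepq _; rewrite leq_add2l.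
by rewrite -(leq_add2l p); apply: leq_trans lepq _; rewrite leq_add2r.
Qed.

(** A multiset of signs is determined by its size and its number of positive
    elements. *)
Lemma sign_perm (s : 'I_n -> int) : sign_vector s ->
  #|[set k | s k == 1]%SET| = #|[set k | eps k == 1]%SET| ->
  exists t : 'S_n, forall k, eps (t k) = s k.
Proof.
move=> hs card_s.
have countE (r : 'I_n -> int) (a : pred int) : sign_vector r ->
    count a [tuple r k | k < n] = (a 1%R * #|[set k | r k == 1%R]%SET| +
                                   a (-1)%R * (n - #|[set k | r k == 1%R]%SET|))%N.
  move=> hr; rewrite -sum1_count big_map big_enum_cond /= big_mkcond /=.
  have cC : #|(~: [set k | r k == 1%R])%SET| = (n - #|[set k | r k == 1%R]%SET|)%N.
    by rewrite cardsCs finset.setCK card_ord.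
  rewrite -cC (bigID (fun k => r k == 1)) /= !(mulnC (nat_of_bool _)) -!sum_nat_const.
  congr (_ + _)%N; apply: eq_big => k; rewrite ?inE //; first by move=> /eqP ->; case: (a 1).
  by case: (hr k) => ->; rewrite ?eqxx //; case: (a (-1)).
have /tuple_permP[t tE] : perm_eq [tuple s k | k < n] [tuple eps k | k < n].
  by apply/seq.permP => a; rewrite !countE // card_s.
exists t => k; have := congr1 (fun r => nth 0 r k) tE.
by rewrite -!tnth_nth !tnth_mktuple.
Qed.

(** The standard basis is permuted so that delta acts on its [k]-th vector [x_k]
    by the sign [s k], with opposite signs on the two elements of a pair.  Then
    [(s k * x_k + x_(w k)) / sqrt 2] is a unit vector mapped by delta to the one
    of index [w k]. *)
Lemma orthonormal_conjugate_exists we : signed_involution we ->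
  pq_inv we n = (\dim (Vplus C eps), \dim (Vminus C eps)) ->
  exists v, orthonormal_tuple v /\ conjugate_basis C eps we v.
Proof.
move=> sw; rewrite pq_invE dim_Vplus => -[pE _]; have wK := invol_perm sw.1.
pose s k : int := if we.1 k == k then we.2 k else if (we.1 k < k)%N then 1 else -1.
have hs : sign_vector s.
  move=> k; rewrite /s; have [_ /(_ k)] := sw; case: eqP => // _ _.
  by case: ltnP; [left|right].
have [|t tE] := @sign_perm s hs.
  rewrite -pE; apply: eq_card => k; rewrite !inE ltn_ord /closes /s.
  case: (eqVneq (we.1 k) k) => [->|_]; first by rewrite ltnn orbF.
  by case: ltnP.
have s_wk k : we.1 k != k -> s (we.1 k) = - s k.
  move=> wk; rewrite /s wK [k == _]eq_sym (negPf wk).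
  by case: (ltngtP k (we.1 k)) => // /val_inj kw; rewrite -kw eqxx in wk.
have ss k : s k * s k = 1 by case: (hs k) => ->; rewrite ?mulr1 ?mulrNN ?mulr1.
pose x k : 'cV[C]_n := delta_mx (t k) 0.
have dx k : delta *m x k = (s k)%:~R *: x k by rewrite Phi_delta tE.
have ox k j : dot (x k) (x j) = (j == k)%:R by rewrite dot_delta (inj_eq perm_inj).
pose r : C := (sqrtC 2)^-1.
have r_conj : r^* = r by apply/CrealP/ger0_real; rewrite invr_ge0 sqrtC_ge0 ler0n.
have rr : r * r + r * r = 1.
  by rewrite -mulr2n -[_ *+ 2]mulr_natr -expr2 exprVn sqrtCK mulVf // pnatr_eq0.
pose a k : C := if we.1 k == k then 1 else r * (s k)%:~R.
pose b k : C := if we.1 k == k then 0 else r.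
pose v := [tuple a k *: x k + b k *: x (we.1 k) | k < n].
have a_conj k : (a k)^* = a k.
  by rewrite /a; case: ifP => _; rewrite ?conjC1 // rmorphM /= r_conj rmorph_int.
have b_conj k : (b k)^* = b k by rewrite /b; case: ifP => _; rewrite ?conjC0.
have ov : orthonormal_tuple v.
  move=> k j; rewrite !tnth_mktuple !(phiDl, phiDr, phiZl, phiZr) !ox a_conj b_conj.
  rewrite (inj_eq perm_inj).
  have [->|jk] := eqVneq j k.
    rewrite [k == _]eq_sym /a /b; have [wk|wk] := eqVneq (we.1 k) k.
      by rewrite !mul0r !addr0 !mulr1.
    rewrite !mulr1 !mulr0 addr0 add0r mulrACA -intrM.
    by rewrite ss mulr1.
  have [jw|jw] := eqVneq j (we.1 k).
    have wk : we.1 k != k by rewrite -jw.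
    rewrite jw wK eqxx /a /b wK (negPf wk) [k == _]eq_sym (negPf wk) s_wk //.
    by rewrite !mulr0 add0r addr0 !mulr1 mulrNz !mulrN -mulrA [_%:~R * r]mulrC subrr.
  have -> : (we.1 j == k) = false by apply: contraNF jw => /eqP <-; rewrite wK.
  by rewrite !mulr0n !mulr0 !addr0 !mulr0 addr0.
exists v; split=> //; apply/conjugate_basisP; split; first exact: orthonormal_basis.
move=> k; rewrite !tnth_mktuple wK mulmxDr -!scalemxAr !dx /coef.
have [wk|wk] := eqVneq (we.1 k) k.
  by rewrite wk /a /b wk eqxx /s wk eqxx !scale0r !addr0 !scale1r.
rewrite /a /b wK [k == _]eq_sym (negPf wk) mulr1z scale1r.
by rewrite !scalerA -mulrA -intrM ss mulr1 addrC.
Qed.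

End Existence.

(** * Orbits and Matsuki duality *)

Section Orbits.
Variables (C : numClosedFieldType) (n : nat) (eps : 'I_n -> int).
Hypothesis heps : sign_vector eps.
Implicit Types (F : preflag C n) (x y z : 'cV[C]_n) (i j k : 'I_n) (l m : nat).
Implicit Types (v u : n.-tuple 'cV[C]_n) (we : 'S_n * {ffun 'I_n -> int}).
Local Notation delta := (Phi C eps).

(** The matrix from one basis to another is unique, so stability of [B] under
    [H], and membership in [H] of the matrices between elements of [B], make the
    flags of [B] one orbit. *)
Lemma orbit_of_bases (H : set 'M[C]_n) (B : set (n.-tuple 'cV[C]_n)) v0 :
  B v0 -> (forall v, B v -> basis_of fullv v) ->
  (forall g v, H g -> B v -> B (act_tuple g v)) ->
  (forall g v, g \in unitmx -> B v -> B (act_tuple g v) -> H g) ->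
  [set flag_of v | v in B] = flag_orbit H (flag_of v0).
Proof.
move=> Bv0 Bbasis HB BH; apply/seteqP; split=> [_ [v Bv <-]|_ [g Hg <-]] /=.
  have [g ug gv] := basis_transitive (Bbasis _ Bv0) (Bbasis _ Bv).
  by exists g; rewrite ?act_flag_of ?gv //; apply: BH Bv0 _ => //; rewrite gv.
by exists (act_tuple g v0); [exact: HB | rewrite act_flag_of].
Qed.

Lemma mulmx_basis_inj (A B : 'M[C]_n) v : basis_of fullv v ->
  (forall k, A *m tnth v k = B *m tnth v k) -> A = B.
Proof.
move=> bv AB; suff h x : A *m x = B *m x.
  apply/matrixP => i j; have := congr1 (fun y : 'cV_n => y i 0) (h (delta_mx j 0)).
  by rewrite -!colE !mxE.
rewrite (coord_expand bv x) !mulmx_sumr; apply: eq_bigr => k _.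
by rewrite -!scalemxAr AB.
Qed.

Lemma conjugate_act we g v : Kgrp C eps g ->
  conjugate_basis C eps we v -> conjugate_basis C eps we (act_tuple g v).
Proof.
case=> ug gd /conjugate_basisP[bv dv]; apply/conjugate_basisP; split=> [|k].
  exact: act_basis.
by rewrite !tnth_act mulmxA gd -mulmxA dv scalemxAr.
Qed.

Lemma conjugate_act_inv we g v : g \in unitmx -> conjugate_basis C eps we v ->
  conjugate_basis C eps we (act_tuple g v) -> Kgrp C eps g.
Proof.
move=> ug /conjugate_basisP[bv dv] /conjugate_basisP[_ dgv]; split=> //.
apply: (mulmx_basis_inj bv) => k; have := dgv k.
by rewrite !tnth_act -!mulmxA dv => ->; rewrite scalemxAr.
Qed.

Lemma dual_act we g v : G0grp C eps g ->
  dual_basis C eps we v -> dual_basis C eps we (act_tuple g v).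
Proof.
case=> ug gphi /dual_basisP[bv dv]; apply/dual_basisP; split=> [|k j].
  exact: act_basis.
by rewrite !tnth_act gphi dv.
Qed.

Lemma dual_act_inv we g v : g \in unitmx -> dual_basis C eps we v ->
  dual_basis C eps we (act_tuple g v) -> G0grp C eps g.
Proof.
move=> ug /dual_basisP[bv dv] /dual_basisP[_ dgv]; split=> // x y.
have gphi k j : phi eps (g *m tnth v k) (g *m tnth v j) = phi eps (tnth v k) (tnth v j).
  by rewrite -!tnth_act dgv dv.
rewrite (coord_expand bv y) mulmx_sumr !phi_sumr; apply: eq_bigr => j _.
rewrite -scalemxAr !phiZr; congr (_ * _).
rewrite -phi_conj -[RHS]phi_conj; congr (_^*).
rewrite (coord_expand bv x) mulmx_sumr !phi_sumr; apply: eq_bigr => k _.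
by rewrite -scalemxAr !phiZr gphi.
Qed.

Lemma conjugate_flags_orbit we v : conjugate_basis C eps we v ->
  conjugate_flags C eps we = flag_orbit (Kgrp C eps) (flag_of v).
Proof.
move=> cv; apply: orbit_of_bases => //.
- by move=> u [].
- exact: conjugate_act.
- exact: conjugate_act_inv.
Qed.

Lemma dual_flags_orbit we v : dual_basis C eps we v ->
  dual_flags C eps we = flag_orbit (G0grp C eps) (flag_of v).
Proof.
move=> dv; apply: orbit_of_bases => //.
- by move=> u [].
- exact: dual_act.
- exact: dual_act_inv.
Qed.

Lemma both_flags_orbit we v : dual_basis C eps we v -> conjugate_basis C eps we v ->
  [set flag_of v | v in dual_basis C eps we `&` conjugate_basis C eps we] =
  flag_orbit (Kgrp C eps `&` G0grp C eps) (flag_of v).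
Proof.
move=> dv cv; apply: orbit_of_bases => //.
- by move=> u [[]].
- by move=> g u [Kg Gg] [du cu]; split; [exact: dual_act|exact: conjugate_act].
- move=> g u ug [du cu] [dgu cgu].
  by split; [exact: conjugate_act_inv cu cgu|exact: dual_act_inv du dgu].
Qed.

Lemma conjugate_dual_inter we : signed_involution we ->
  conjugate_flags C eps we `&` dual_flags C eps we =
  [set flag_of v | v in dual_basis C eps we `&` conjugate_basis C eps we].
Proof.
move=> sw; apply/seteqP; split=> [F [cF dF]|F [v [dv cv] <-]] /=.
  by have [v [dv cv ->]] := conjugate_dual_basis heps sw cF dF; exists v.
by split; exists v.
Qed.

Lemma dual_flags_inj we we' F : signed_involution we -> signed_involution we' ->
  dual_flags C eps we F -> dual_flags C eps we' F -> we = we'.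
Proof.
move=> sw sw' dF dF'; apply: invariants_inj => // [m l mn ln|l ln].
  apply: (@addIn (rank_count (we.1 * w0 n)%g (n - m) l)); rewrite rank_count_w0 //.
  rewrite -(dual_flags_rank sw dF) // (dual_flags_rank sw' dF') //.
  by rewrite rank_count_w0.
exact: is_signature_uniq (dual_flags_sig sw dF ln) (dual_flags_sig sw' dF' ln).
Qed.

Lemma sig_invP we (f : nat -> nat * nat) : f 0%N = (0, 0)%N ->
  [ffun l : 'I_n => f l.+1] = sig_inv we <->
  (forall l, (l <= n)%N -> f l = pq_inv we l).
Proof.
move=> f0; have pq0 : pq_inv we 0 = (0, 0)%N.
  by rewrite pq_invE; congr (_, _); apply: fintype.eq_card0 => k; rewrite inE.
split=> [/ffunP h [|l] ln|h]; first by rewrite f0 pq0.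
  by have := h (Ordinal ln); rewrite !ffunE.
by apply/ffunP => l; rewrite !ffunE h.
Qed.

Lemma lift0_part F (l : 'I_n) : F (lift ord0 l) = part F l.+1.
Proof. by rewrite partE. Qed.

Lemma sig_deltaP we F : flags C n F -> sig_delta eps F = sig_inv we <->
  (forall l, (l <= n)%N -> (\dim (part F l :&: Vplus C eps)%VS,
     \dim (part F l :&: Vminus C eps)%VS) = pq_inv we l).
Proof.
move=> fF; rewrite -sig_invP; last by rewrite part0 // !cap0v dimv0.
by under eq_ffun do rewrite -lift0_part.
Qed.

Lemma sig_phiP we F : flags C n F -> sig_phi eps F = sig_inv we <->
  (forall l, (l <= n)%N -> signature eps (part F l) = pq_inv we l).
Proof.
move=> fF; rewrite -(@sig_invP we (fun l => signature eps (part F l))).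
  by under eq_ffun do rewrite -lift0_part.
rewrite part0 //; apply: signatureE; exists [::].
split=> //; first exact: nil_free.
  by rewrite span_nil cap0v.
by rewrite span_nil add0v cap0v.
Qed.

Lemma relposP (w : 'S_n) F F' : relpos C w (F, F') <->
  [/\ flags C n F, flags C n F' & forall m l, (m <= n)%N -> (l <= n)%N ->
     \dim (part F m :&: part F' l)%VS = rank_count w m l].
Proof.
split=> [[/= fF fF' h]|[fF fF' h]]; split=> //=.
  by move=> m l mn ln; rewrite h !inordK.
by move=> k l; rewrite !partE h // -ltnS.
Qed.

Lemma conjugate_flags_char we : signed_involution we ->
  conjugate_flags C eps we = [set F : preflag C n |
    [/\ flags C n F, relpos C we.1 (flag_delta eps F, F) & sig_delta eps F = sig_inv we]].
Proof.
move=> sw; apply/seteqP; split=> F /= [].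
  move=> v cv Fv; have cF : conjugate_flags C eps we F by exists v.
  have fF := conjugate_flags_flags cF; split=> //.
    apply/relposP; split=> // [|m l mn ln]; last exact: conjugate_flags_rank.
    exact: flags_act (unit_Phi C heps) fF.
  by apply/sig_deltaP => // l; apply: conjugate_flags_sig.
move=> fF /relposP[_ _ rk] /(sig_deltaP _ fF) sg.
have [we' [v [sw' cv Fv]]] := conjugate_exists heps fF.
have cF : conjugate_flags C eps we' F by exists v.
suff -> : we = we' by [].
apply: invariants_inj => // [m l mn ln|l ln].
  by rewrite -rk // (conjugate_flags_rank heps sw' cF).
by rewrite -sg // (conjugate_flags_sig sw' cF).
Qed.

Lemma dual_flags_char we : signed_involution we ->
  dual_flags C eps we = [set F : preflag C n |
    [/\ flags C n F, relpos C (we.1 * w0 n)%g (flag_dag eps F, F) & sig_phi eps F = sig_inv we]].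
Proof.
move=> sw; apply/seteqP; split=> F /= [].
  move=> v dv Fv; have dF : dual_flags C eps we F by exists v.
  have fF := dual_flags_flags dF; split=> //.
    apply/relposP; split=> // [|m l mn ln]; first by rewrite -Fv; apply: flags_dag_dual sw dv.
    by rewrite -Fv; apply: dual_rank sw dv _ _ mn ln.
  by apply/sig_phiP => // l ln; apply/signatureE/dual_flags_sig.
move=> fF /relposP[_ _ rk] /(sig_phiP _ fF) sg.
have [we' [v [sw' dv Fv]]] := dual_exists heps fF.
have dF : dual_flags C eps we' F by exists v.
suff -> : we = we' by [].
apply: invariants_inj => // [m l mn ln|l ln].
  apply: (@addIn (rank_count (we.1 * w0 n)%g (n - m) l)); rewrite rank_count_w0 //.
  rewrite -rk ?leq_subr // part_dag ?leq_subr // subKn //.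
  by rewrite (dual_flags_rank sw' dF) // rank_count_w0.
by rewrite -sg //; apply/signatureE/dual_flags_sig.
Qed.

Local Notation I := (signed_involutions n (\dim (Vplus C eps)) (\dim (Vminus C eps))).

Lemma both_basis_exists we : I we ->
  exists v, dual_basis C eps we v /\ conjugate_basis C eps we v.
Proof.
case=> sw pq; have [v [ov cv]] := orthonormal_conjugate_exists heps sw pq.
by exists v; split=> //; apply: conjugate_orthonormal_dual.
Qed.

Lemma conjugate_cover F : flags C n F -> exists2 we, I we & conjugate_flags C eps we F.
Proof.
move=> /(conjugate_exists heps)[we [v [sw cv ->]]].
by exists we; [split=> //; apply: (@signature_of_conjugate _ _ _ _ (flag_of v) sw)|]; exists v.
Qed.

Lemma dual_cover F : flags C n F -> exists2 we, I we & dual_flags C eps we F.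
Proof.
move=> /(dual_exists heps)[we [v [sw dv ->]]].
by exists we; [split=> //; apply: (@signature_of_dual _ _ _ heps _ (flag_of v) sw)|]; exists v.
Qed.

Lemma conjugate_flags_orbits :
  [set conjugate_flags C eps we | we in I] = flag_orbits (Kgrp C eps).
Proof.
apply/seteqP; split=> [_ [we Iwe <-]|_ [F fF <-]] /=.
  have [v [_ cv]] := both_basis_exists Iwe; exists (flag_of v).
    by case: cv => bv _; apply: flag_of_basis.
  by rewrite (conjugate_flags_orbit cv).
have [we Iwe [v cv <-]] := conjugate_cover fF.
by exists we => //; apply: conjugate_flags_orbit.
Qed.

Lemma dual_flags_orbits :
  [set dual_flags C eps we | we in I] = flag_orbits (G0grp C eps).
Proof.
apply/seteqP; split=> [_ [we Iwe <-]|_ [F fF <-]] /=.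
  have [v [dv _]] := both_basis_exists Iwe; exists (flag_of v).
    by case: dv => bv _; apply: flag_of_basis.
  by rewrite (dual_flags_orbit dv).
have [we Iwe [v dv <-]] := dual_cover fF.
by exists we => //; apply: dual_flags_orbit.
Qed.

Lemma conjugate_flags_neq0 we : I we -> conjugate_flags C eps we !=set0.
Proof. by case/both_basis_exists => v [_ cv]; exists (flag_of v), v. Qed.

Lemma dual_flags_neq0 we : I we -> dual_flags C eps we !=set0.
Proof. by case/both_basis_exists => v [dv _]; exists (flag_of v), v. Qed.

Lemma eq_conjugate_flags we we' : I we -> I we' ->
  conjugate_flags C eps we = conjugate_flags C eps we' -> we = we'.
Proof.
move=> Iwe [sw' _] eqc; have [F cF] := conjugate_flags_neq0 Iwe; case: Iwe => sw _.
by apply: (conjugate_flags_inj heps sw sw' cF); rewrite -eqc.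
Qed.

Lemma eq_dual_flags we we' : I we -> I we' ->
  dual_flags C eps we = dual_flags C eps we' -> we = we'.
Proof.
move=> Iwe [sw' _] eqd; have [F dF] := dual_flags_neq0 Iwe; case: Iwe => sw _.
by apply: (dual_flags_inj sw sw' dF); rewrite -eqd.
Qed.

(** The sum of all the invariants, strictly increasing for their componentwise
    order: a measure for the induction in the uniqueness of the duality. *)
Definition height we : nat :=
  ((\sum_(m < n.+1) \sum_(l < n.+1) rank_count we.1 m l) +
   (\sum_(l < n.+1) ((pq_inv we l).1 + (pq_inv we l).2)))%N.

Lemma height_le we : (height we <= n.+1 * (n.+1 * n) + n.+1 * (n + n))%N.
Proof.
have card_le (A : {set 'I_n}) : (#|A| <= n)%N by rewrite -[leqRHS]card_ord max_card.
have sum_le (f : 'I_n.+1 -> nat) (c : nat) : (forall t, (f t <= c)%N) ->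
    (\sum_(i < n.+1) f i <= n.+1 * c)%N.
  move=> fc; apply: (@leq_trans (\sum_(t < n.+1) c)%N); first by apply: leq_sum.
  by rewrite sum_nat_const card_ord.
apply: leq_add; apply: (sum_le) => m; first by apply: (sum_le) => l; apply: card_le.
by rewrite pq_invE; apply: leq_add; apply: (card_le).
Qed.

Lemma leq_sum_eq N (f g : 'I_N -> nat) : (forall t, (f t <= g t)%N) ->
  (\sum_t g t <= \sum_t f t)%N -> forall t, f t = g t.
Proof.
move=> fg gf; have fgE t : true -> (f t <= g t ?= iff (f t == g t))%N.
  by move=> _; apply: leqif_eq.
by have := leqif_sum fgE => /geq_leqif; rewrite gf => /esym/forall_inP h i; apply/eqP/h.
Qed.

Lemma leq_add_eq a b a' b' : (a <= a')%N -> (b <= b')%N -> (a' + b' <= a + b)%N ->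
  (a' <= a)%N /\ (b' <= b)%N.
Proof.
move=> aa bb ab; split; first by rewrite -(leq_add2r b') (leq_trans ab) // leq_add2l.
by rewrite -(leq_add2l a') (leq_trans ab) // leq_add2r.
Qed.

Lemma incident_eq_or_lt we we' F : signed_involution we -> signed_involution we' ->
  conjugate_flags C eps we F -> dual_flags C eps we' F ->
  we = we' \/ (height we < height we')%N.
Proof.
move=> sw sw' cF dF; have [rk pq] := conjugate_dual_le heps sw sw' cF dF.
have le1 (m l : 'I_n.+1) : (rank_count we.1 m l <= rank_count we'.1 m l)%N.
  by apply: rk; rewrite -ltnS.
have le2 (l : 'I_n.+1) : ((pq_inv we l).1 + (pq_inv we l).2 <=
                          (pq_inv we' l).1 + (pq_inv we' l).2)%N.
  by have [|h1 h2] := pq l; [rewrite -ltnS | apply: leq_add].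
have le3 (m : 'I_n.+1) :
  (\sum_(l < n.+1) rank_count we.1 m l <= \sum_(l < n.+1) rank_count we'.1 m l)%N.
  by apply: leq_sum.
have le4 : (\sum_(m < n.+1) \sum_(l < n.+1) rank_count we.1 m l <=
            \sum_(m < n.+1) \sum_(l < n.+1) rank_count we'.1 m l)%N by apply: leq_sum.
have le5 : (\sum_(l < n.+1) ((pq_inv we l).1 + (pq_inv we l).2) <=
            \sum_(l < n.+1) ((pq_inv we' l).1 + (pq_inv we' l).2))%N by apply: leq_sum.
have : (height we <= height we')%N by apply: leq_add.
rewrite leq_eqVlt => /predU1P[hE|]; last by right.
left; have [ge4 ge5] := leq_add_eq le4 le5 (eq_leq (esym hE)).
apply: invariants_inj => // [m l mn ln|l ln].
  have /esym/eq_leq ge3 := leq_sum_eq le3 ge4 (inord m).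
  by have := leq_sum_eq (le1 _) ge3 (inord l); rewrite !inordK.
have [le_p le_q] := pq l ln; have := leq_sum_eq le2 ge5 (inord l); rewrite inordK // => e.
have [ge_p ge_q] := leq_add_eq le_p le_q (eq_leq (esym e)).
by case: (pq_inv we l) (pq_inv we' l) le_p le_q ge_p ge_q => [p q] [p' q'] /= *;
  congr (_, _); apply/eqP; rewrite eqn_leq; apply/andP.
Qed.

(** Defined on all sets of flags without choosing a signed involution; outside
    the K-orbits it is empty. *)
Definition matsuki_map (O : set (preflag C n)) : set (preflag C n) :=
  [set F | exists we, [/\ I we, O = conjugate_flags C eps we & dual_flags C eps we F]].

Lemma matsuki_mapE we : I we -> matsuki_map (conjugate_flags C eps we) = dual_flags C eps we.
Proof.
move=> Iwe; apply/seteqP; split=> [F [we' [Iwe' eqO dF]]|F dF] /=; last by exists we.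
by rewrite (eq_conjugate_flags Iwe Iwe' eqO).
Qed.

Lemma matsuki_map_condition : matsuki_condition eps matsuki_map.
Proof.
split=> [|O]; last first.
  rewrite -conjugate_flags_orbits => -[we Iwe <-]; rewrite matsuki_mapE //.
  have [v [dv cv]] := both_basis_exists Iwe.
  rewrite conjugate_dual_inter; last by case: Iwe.
  exists (flag_of v); first by case: dv => bv _; apply: flag_of_basis.
  by rewrite (both_flags_orbit dv cv).
rewrite -conjugate_flags_orbits -dual_flags_orbits; split.
- by move=> _ [we Iwe <-] /=; rewrite matsuki_mapE //; exists we.
- move=> O O' /set_mem[we Iwe <-] /set_mem[we' Iwe' <-]; rewrite !matsuki_mapE // => eqd.
  by rewrite (eq_dual_flags Iwe Iwe' eqd).
- by move=> _ [we Iwe <-] /=; exists (conjugate_flags C eps we); [exists we|rewrite matsuki_mapE].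
Qed.

(** Along any bijection with the incidence property the height does not
    decrease; descending induction on the height then forces equality. *)
Lemma matsuki_unique Xi : matsuki_condition eps Xi ->
  forall we, I we -> Xi (conjugate_flags C eps we) = dual_flags C eps we.
Proof.
rewrite /matsuki_condition -conjugate_flags_orbits -dual_flags_orbits.
case=> -[Xifun Xiinj _] Xiinter we.
have [N] := ubnP (n.+1 * (n.+1 * n) + n.+1 * (n + n) - height we)%N.
elim: N we => // N IHN we; rewrite ltnS => leN Iwe.
have Owe : [set conjugate_flags C eps we | we in I] (conjugate_flags C eps we) by exists we.
have [we' Iwe' XiE] := Xifun _ Owe.
have [F [cF dF]] : (conjugate_flags C eps we `&` dual_flags C eps we') !=set0.
  rewrite XiE; have [F fF <-] := Xiinter _ Owe; exists F; exists 1%:M.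
    split; split; rewrite ?unitmx1 ?mulmx1 ?mul1mx // => x y.
    by rewrite !mul1mx.
  apply: eq_part => l ln; rewrite part_act; apply/vspaceP => x.
  by rewrite vimgE ?unitmx1 // invmx1 mul1mx.
have [ewe|lt] := incident_eq_or_lt Iwe.1 Iwe'.1 cF dF; first by rewrite -XiE ewe.
have Owe' : [set conjugate_flags C eps we | we in I] (conjugate_flags C eps we') by exists we'.
have : Xi (conjugate_flags C eps we') = dual_flags C eps we'.
  apply: IHN => //; apply: leq_trans leN.
  by apply: ltn_sub2l => //; apply: leq_trans lt _; apply: height_le.
rewrite XiE => /Xiinj eqO.
have /eq_conjugate_flags := eqO (mem_set Owe') (mem_set Owe).
by move=> /(_ Iwe' Iwe) ewe; rewrite ewe ltnn in lt.
Qed.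

End Orbits.

Theorem proposition5 (R : realType) (n : nat) (eps : 'I_n -> int)
    (heps : sign_vector eps) :
  let C : numClosedFieldType := R[i] in
  let I := signed_involutions n (\dim (Vplus C eps)) (\dim (Vminus C eps)) in
  [/\ (* (a) *)
      forall we, I we ->
        [/\ conjugate_flags C eps we !=set0,
            dual_flags C eps we !=set0,
            conjugate_flags C eps we `&` dual_flags C eps we =
              [set flag_of v | v in dual_basis C eps we
                                    `&` conjugate_basis C eps we]
          & conjugate_flags C eps we `&` dual_flags C eps we !=set0],
      (* (b); the permutation w0 o w is written w * w0 in 'S_n *)
      forall we, I we ->
        conjugate_flags C eps we =
          [set F : preflag C n | [/\ flags C n F,
                       relpos C we.1 (flag_delta eps F, F)
                     & sig_delta eps F = sig_inv we]] /\
        dual_flags C eps we =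
          [set F : preflag C n | [/\ flags C n F,
                       relpos C (we.1 * w0 n)%g (flag_dag eps F, F)
                     & sig_phi eps F = sig_inv we]],
      (* (c) *)
      [set conjugate_flags C eps we | we in I] = flag_orbits (Kgrp C eps) /\
      [set dual_flags C eps we | we in I] = flag_orbits (G0grp C eps)
    & (* (d) *)
      exists Xi : set (preflag C n) -> set (preflag C n),
        matsuki_duality eps Xi /\
        forall we, I we -> Xi (conjugate_flags C eps we) = dual_flags C eps we].
Proof.
move=> C I; split=> [we Iwe|we [sw _]||].
- have [v [dv cv]] := both_basis_exists heps Iwe; split.
  + exact: conjugate_flags_neq0.
  + exact: dual_flags_neq0.
  + by apply: conjugate_dual_inter => //; case: Iwe.
  + by exists (flag_of v); split; exists v.
- by split; [apply: conjugate_flags_char|apply: dual_flags_char].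
- by split; [apply: conjugate_flags_orbits|apply: dual_flags_orbits].
exists (@matsuki_map C n eps); split; last by move=> we; apply: matsuki_mapE.
split; first exact: matsuki_map_condition.
move=> Xi' cXi' O; rewrite -conjugate_flags_orbits // => -[we Iwe <-].
by rewrite matsuki_mapE // matsuki_unique.
Qed.
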